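(* Let $P,Q\in\mathcal{L}(n)$. Suppose $P$ is minimally resolved by its Scarf complex, $Q\geq P$ in $\mathcal{L}(n)$, and the total Betti numbers of $Q$ are the same as the total Betti numbers of $P$. Then $Q$ is also (minimally) resolved by its Scarf complex, and the Scarf complex of $Q$ equals the Scarf complex of $P$ (as simplicial complexes on the common ordered set of $n$ atoms).
   Context: Fix a field $k$. A finite atomic lattice is a finite lattice (with minimum $\hat 0$, maximum $\hat 1$) in which every element other than $\hat 0$ is a join of atoms, an atom being an element covering $\hat 0$. $\mathcal{L}(n)$ is the set of all finite atomic lattices with $n$ ordered atoms $a_1,\dots,a_n$ (up to isomorphism respecting the ordering of the atoms), partially ordered by: $Q\leq P$ if and only if there is a join-preserving map $P\to Q$ which is a bijection on atoms (sending $a_i$ to $a_i$). The LCM lattice of a monomial ideal $M$ in a polynomial ring $R$ over $k$ is the set of lcms of all subsets of its minimal monomial generators (with $1$ the lcm of the empty set), ordered by divisibility. Every finite atomic lattice $P$ is the LCM lattice of some monomial ideal $M$ (a coordinatization of $P$), and the minimal free resolution of $R/M$ depends, up to relabeling of multidegrees, only on $P$. The multigraded Betti numbers of $P$ are $\beta_{i,p}=\dim_k\tilde H_{i-2}(\Delta(\hat 0,p);k)$ for $p\in P\setminus\{\hat 0\}$, $i\ge 1$, where $\Delta(\hat 0,p)$ is the order complex of the open interval $(\hat 0,p)$ (with $\tilde H_{-1}(\emptyset;k)=k$), and $\beta_{0,\hat 0}=1$ with all other $\beta_{0,p}$ and $\beta_{i,\hat 0}$ equal to $0$. The total Betti numbers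 of $P$ are $\beta_i=\sum_{p\in P}\beta_{i,p}$; they are the total Betti numbers of $R/M$. For $p\in P$, $\mathrm{equiv}_P(p)$ is the set of all subsets of $\mathrm{atoms}(P)$ whose join in $P$ equals $p$. The Scarf complex of $P$ is the simplicial complex whose vertices are the atoms and whose faces are the subsets $\sigma$ of atoms such that, for $p=\bigvee\sigma$, $|\mathrm{equiv}_P(p)|=1$ (i.e. $\sigma$ is the only set of atoms with join $p$). A cell complex $X$ with vertex set the atoms of $P$ supports a (minimal) free resolution of $P$ if, for a coordinatization $M$ of $P$, labeling each vertex $a_i$ by the corresponding generator of $M$ and each face by the lcm of the labels of its vertices, the associated cellular complex of free $R$-modules (one generator for each face, including the empty face, in the multidegree of its label, with the cellular boundary map homogenized by the labels) is a (minimal) free resolution of $R/M$. ''$P$ is minimally resolved by its Scarf complex'' means that its Scarf complex supports the minimal free resolution of $P$ in this sense. *)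

(* Defs.v *)
From HB Require Import structures.
From mathcomp Require Export all_boot all_order all_algebra.
From mathcomp Require Export mpoly.

Set Implicit Arguments.
Unset Strict Implicit.
Unset Printing Implicit Defensive.

Import Order.TTheory GRing.Theory.

Local Open Scope ring_scope.

(** * Finite atomic lattices with [n] ordered atoms *)

Section AtomicLattice.
Local Open Scope order_scope.

Definition is_atom d (L : finTBLatticeType d) (x : L) : Prop :=
  \bot < x /\ forall y : L, ~~ (\bot < y < x).

(* [a] lists all the atoms of [L] without repetition.  The element [\bot] is the
   empty join. *)
Definition atomic_lattice d (L : finTBLatticeType d) n (a : 'I_n -> L) : Prop :=
  [/\ injective a,
      forall x : L, is_atom x <-> exists i, a i = x
    & forall x : L, x != \bot ->
        exists s : {set 'I_n}, x = \join_(i in s) a i].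

(* [P <= Q] in L(n): there is a join-preserving map from [Q] to [P] sending the
   [i]-th atom to the [i]-th atom. *)
Definition atomic_le dP dQ (P : finTBLatticeType dP) (Q : finTBLatticeType dQ)
    n (aP : 'I_n -> P) (aQ : 'I_n -> Q) : Prop :=
  exists f : Q -> P,
    Order.join_morphism f /\ forall i, f (aQ i) = aP i.

End AtomicLattice.

(** * Reduced simplicial homology *)

(* A simplicial complex is given by the set of its faces, including the empty
   face.  Its vertices are ordered by [enum_rank]; on ['I_n] this is the usual
   order. *)
Section Homology.
Variables (T : finType) (k : fieldType).

Definition incidence (v : T) (s : {set T}) : nat :=
  #|[set w in s | enum_rank w < enum_rank v]|%N.

Definition simplicial_complex (D : {set {set T}}) : Prop :=
  [/\ set0 \in D, forall v, [set v] \in D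
    & forall s t : {set T}, s \in D -> t \subset s -> t \in D].

(* The coefficient at [t] of the augmented boundary of [c]; the sum runs over the
   cofaces [v |: t] of [t]. *)
Definition bd_fun (c : {ffun {set T} -> k^o}) : {ffun {set T} -> k^o} :=
  [ffun t : {set T} =>
     \sum_(v | v \notin t) (-1) ^+ incidence v (v |: t) * c (v |: t) : k^o].

Fact bd_fun_is_linear : linear bd_fun.
Proof.
move=> x c c'; apply/ffunP => t; rewrite !ffunE [LHS]/=.
rewrite scaler_sumr -big_split; apply: eq_bigr => v _ /=.
by rewrite !ffunE mulrDr /GRing.scale /= mulrCA.
Qed.

HB.instance Definition _ := GRing.isLinear.Build k _ _ _ bd_fun bd_fun_is_linear.

Definition bd : 'End({ffun {set T} -> k^o}) := linfun bd_fun.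

(* Chains of dimension [j - 1], that is, on faces with [j] vertices. *)
Definition chains (D : {set {set T}}) (j : nat) : {vspace {ffun {set T} -> k^o}} :=
  <<[seq [ffun t => (t == s)%:R : k^o] | s <- enum [set s in D | #|s| == j]]>>%VS.

(* dim H~_(j-1)(D; k) *)
Definition redH_dim (D : {set {set T}}) (j : nat) : nat :=
  (\dim (chains D j :&: lker bd) - \dim (bd @: chains D j.+1))%N.

End Homology.

(** * Betti numbers *)

Section Betti.
Variables (k : fieldType) (d : Order.disp_t) (L : finTBLatticeType d).
Local Open Scope order_scope.

(* Order complex of the open interval (0, p). *)
Definition order_complex (p : L) : {set {set L}} :=
  [set C : {set L} | [forall x in C, \bot < x < p]
                  && [forall x in C, forall y in C, x >=< y]].

(* For [i = j.+1], H~_(i-2) is H~_(j-1). *)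
Definition betti (i : nat) (p : L) : nat :=
  if i is j.+1 then
    if p == \bot then 0%N else redH_dim k (order_complex p) j
  else (p == \bot).

Definition total_betti (i : nat) : nat := (\sum_(p : L) betti i p)%N.

End Betti.

(** * The Scarf complex *)

Section Scarf.
Variables (d : Order.disp_t) (L : finTBLatticeType d) (n : nat) (a : 'I_n -> L).
Local Open Scope order_scope.

(* Sets of atoms are identified with sets of indices. *)
Definition equiv (p : L) : {set {set 'I_n}} :=
  [set s : {set 'I_n} | \join_(i in s) a i == p].

Definition scarf : {set {set 'I_n}} :=
  [set s : {set 'I_n} | #|equiv (\join_(i in s) a i)| == 1%N].

End Scarf.

(** * Monomial ideals and cellular resolutions *)

Section Cellular.
Variables (k : fieldType) (m n : nat).
(* Exponents of the minimal monomial generators. *)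
Variable g : 'I_n -> 'X_{1..m}.

Definition minimal_generators : Prop := forall i j, (g i <= g j)%MM -> i = j.

Definition lcm_label (s : {set 'I_n}) : 'X_{1..m} :=
  \big[@mlcm m/0%MM]_(i in s) g i.

Definition in_ideal (r : {mpoly k[m]}) : Prop :=
  exists h : 'I_n -> {mpoly k[m]}, r = \sum_(i < n) h i * 'X_[g i].

(* The LCM lattice of the ideal generated by the ['X_[g i]] is isomorphic to [L],
   with ['X_[g i]] corresponding to the atom [a i]. *)
Definition coordinatization d (L : finTBLatticeType d) (a : 'I_n -> L) : Prop :=
  minimal_generators /\
  exists phi : L -> 'X_{1..m},
    [/\ forall x y, (x <= y)%O = (phi x <= phi y)%MM,
        forall u, (exists x, phi x = u) <-> (exists s, lcm_label s = u)
      & forall i, phi (a i) = g i].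

Variable D : {set {set 'I_n}}.

Let Chain := {ffun {set 'I_n} -> {mpoly k[m]}}.

(* The free module on the faces of [D] with [j] vertices. *)
Definition in_cell (j : nat) (c : Chain) : Prop :=
  forall s, c s != 0 -> s \in D /\ #|s| = j.

(* The basis element of the face [s] has multidegree [lcm_label s], whence the
   homogenizing factors. *)
Definition cell_bd (c : Chain) : Chain :=
  [ffun t : {set 'I_n} =>
     \sum_(v | v \notin t) (-1) ^+ incidence v (v |: t)
        * 'X_[(lcm_label (v |: t) - lcm_label t)%MM] * c (v |: t)].

(* The cellular complex, augmented by the projection of the free module on the
   empty face (a copy of the polynomial ring) onto its quotient by the ideal, is
   exact. *)
Definition cellular_resolution : Prop :=
  (forall r, in_ideal r <-> exists2 c, in_cell 1 c & cell_bd c set0 = r) /\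
  (forall j c, in_cell j.+1 c ->
     (cell_bd c = 0 <-> exists2 b, in_cell j.+2 b & cell_bd b = c)).

(* The image of the differential lies in the product with the ideal of all
   variables, i.e. has coordinates without constant term. *)
Definition cellular_minimal : Prop :=
  forall j c, in_cell j c -> forall t, (cell_bd c t)@_0%MM = 0.

End Cellular.

Definition supports_minimal_resolution (k : fieldType) d
    (L : finTBLatticeType d) n (a : 'I_n -> L) (D : {set {set 'I_n}}) : Prop :=
  simplicial_complex D /\
  exists m (g : 'I_n -> 'X_{1..m}),
    [/\ coordinatization g a, cellular_resolution k g D
      & cellular_minimal k g D].

Definition minimally_resolved_by_scarf (k : fieldType) d
    (L : finTBLatticeType d) n (a : 'I_n -> L) : Prop :=
  supports_minimal_resolution k a (scarf a).

(* Main.v *)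
From HB Require Import structures.
Require Import Defs.

Set Implicit Arguments.
Unset Strict Implicit.
Unset Printing Implicit Defensive.

Import Order.TTheory GRing.Theory.

Local Open Scope ring_scope.

(** Write T_p for the family of sets of atoms whose join is p, and S for the Scarf
    complex.  Everything rests on a description of both Betti numbers and Scarf
    resolutions by the same families T_p.

    Let p be other than the minimum.  The sets of atoms with join at most p form a full
    simplex on at least one vertex, which is acyclic, and those with join less than p form a complex with the homology of the open interval
    (0, p), by the crosscut theorem.  Hence the multigraded Betti number of p in
    homological degree i is the i-th homology of the pair, that is of the quotient
    chain complex carried by T_p ([bettiE]).  If p is the join of a Scarf face s then
    T_p is the single set s and contributes one to the Betti number of degree #|s|;
    therefore the total Betti numbers are the face numbers of S plus the contributions
    of the remaining p ([total_bettiE]).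

    The Scarf complex supports a minimal resolution exactly when those remaining
    contributions vanish ([minimally_resolved_by_scarfP]).  Indeed, splitting the
    cellular complex by multidegree shows that it is a resolution if and only if, for
    every p other than the minimum, the part of S with joins at most p is acyclic
    ([exact_cells_strands], [exact_strands_cells], [exact_strands_acyclic]).  This part
    sits in a full simplex, and the quotient is filtered with subquotients T_q, where q
    runs over the elements below p which are not joins of Scarf faces.  If all these T_q
    are acyclic, then so is the quotient ([acyclic_scarf_upto]); conversely, acyclicity of
    all the quotients isolates each T_q by induction on q ([acyclic_equiv_nonscarf]).

    Let now Q >= P.  A join-preserving map from Q to P identifies more joins, so the
    Scarf complex of P is contained in that of Q ([scarf_subset]).  The
    total Betti numbers of P are the face numbers of its Scarf complex, those of Q are at
    least the face numbers of its own, and the two agree.  All the inequalities are then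
    equalities: the two Scarf complexes coincide, and nothing is left in the Betti
    numbers of Q for the elements which are not joins of Scarf faces. *)

(** * Homology of convex families of finite sets *)

(** Homology is only recorded by its dimension, as a difference of dimensions of cycles and
    boundaries, so isomorphisms Z / B -> Z' / B' are used through this equality. *)
Lemma dimv_quotient_eq (k : fieldType) (V V' : vectType k) (f : 'Hom(V, V'))
    (B Z : {vspace V}) (B' Z' : {vspace V'}) :
    (B <= Z)%VS ->
    {in Z, forall z, f z \in Z'} -> {in B, forall z, f z \in B'} ->
    {in Z, forall z, f z \in B' -> z \in B} ->
    (B' <= Z')%VS -> {in Z', forall z', exists2 z, z \in Z & z' - f z \in B'} ->
  (\dim Z - \dim B = \dim Z' - \dim B')%N.
Proof.
move=> sBZ fZ fB injf sBZ' surjf.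
have kerE : (Z :&: lker f = B :&: lker f)%VS.
  apply/eqP; rewrite eqEsubv [X in _ && X]capvS // andbT; apply/subvP => z.
  rewrite !memv_cap memv_ker => /andP[zZ /eqP fz0].
  by rewrite fz0 eqxx andbT; apply: injf; rewrite // fz0 mem0v.
have imE : (f @: B = f @: Z :&: B')%VS.
  apply/eqP; rewrite eqEsubv; apply/andP; split.
    rewrite subv_cap limgS //; apply/subvP => _ /memv_imgP[z zB ->].
    exact: fB.
  apply/subvP => y; rewrite memv_cap => /andP[/memv_imgP[z zZ ->] fzB].
  exact: memv_img (injf z zZ fzB).
have sumE : (f @: Z + B' = Z')%VS.
  apply/eqP; rewrite eqEsubv subv_add sBZ' andbT; apply/andP; split.
    by apply/subvP => _ /memv_imgP[z zZ ->]; apply: fZ.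
  apply/subvP => z' /surjf[z zZ z'B]; rewrite -(subrK (f z) z') addrC.
  by rewrite memv_add // memv_img.
have := dimv_sum_cap (f @: Z)%VS B'; rewrite sumE -imE.
have := limg_ker_dim f Z; have := limg_ker_dim f B; rewrite kerE.
move=> <- <- dimE; rewrite subnDl.
have leB : (\dim (f @: B) <= \dim (f @: Z))%N by rewrite dimvS // limgS.
have leB' := dimvS sBZ'.
by apply/eqP; rewrite -(eqn_add2r (\dim B')) subnK // addnBAC // -dimE addnK.
Qed.

Section Homology.
Variables (T : finType) (k : fieldType) (o : T -> nat).
Hypothesis o_inj : injective o.

Local Notation chain := {ffun {set T} -> k^o}.
Implicit Types (U V W : {set {set T}}) (r s t : {set T}) (c e : chain).

(** Vertices are ordered by an arbitrary injection [o] into the natural numbers.  A complex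
    whose vertices come from two types can then be ordered so that the vertices of each type
    keep the order they have on their own. *)
Definition inc (v : T) s : nat := #|[set w in s | (o w < o v)%N]|.

Definition bdo c : chain :=
  [ffun t : {set T} => \sum_(v | v \notin t) (-1) ^+ inc v (v |: t) * c (v |: t) : k^o].

Fact bdo_is_linear : linear bdo.
Proof.
move=> x c c'; apply/ffunP => t; rewrite !ffunE [LHS]/=.
rewrite scaler_sumr -big_split; apply: eq_bigr => v _ /=.
by rewrite !ffunE mulrDr /GRing.scale /= mulrCA.
Qed.

HB.instance Definition _ := GRing.isLinear.Build k _ _ _ bdo bdo_is_linear.

Lemma incU1 v w s : w \notin s -> inc v (w |: s) = ((o w < o v)%N + inc v s)%N.
Proof.
move=> ws; rewrite /inc; case: ltnP => [wv|wv].
  rewrite (_ : [set _ in _ | _] = w |: [set u in s | (o u < o v)%N]).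
    by rewrite cardsU1 inE (negbTE ws).
  by apply/setP => u; rewrite !inE; case: eqVneq => // ->; rewrite wv.
rewrite add0n; apply: eq_card => u; rewrite !inE.
by case: eqVneq => // ->; rewrite ltnNge wv !andbF.
Qed.

Lemma incU1_self v s : inc v (v |: s) = inc v s.
Proof.
by apply: eq_card => u; rewrite !inE; case: eqVneq => // ->; rewrite ltnn !andbF.
Qed.

(** The sign rule behind both the vanishing of the squared boundary and the contraction of
    a cone: removing two vertices in the two possible orders gives opposite signs. *)
Lemma inc_swap v w s : v != w -> v \notin s -> w \notin s ->
  (-1) ^+ inc v (w |: s) * (-1) ^+ inc w s
    = - ((-1) ^+ inc w (v |: s) * (-1) ^+ inc v s) :> k.
Proof.
move=> vw vs ws; rewrite !incU1 // !exprD.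
have : o v != o w by rewrite (inj_eq o_inj).
by case: ltngtP => //= _ _; rewrite !expr0 !expr1 !mul1r mulN1r ?opprK ?mulNr ?opprK mulrC.
Qed.

Lemma bdoK c : bdo (bdo c) = 0.
Proof.
apply/ffunP => t; rewrite !ffunE.
under eq_bigr => v vt do rewrite ffunE mulr_sumr.
pose F v w : k := (-1) ^+ inc v (v |: t) *
  ((-1) ^+ inc w (w |: (v |: t)) * c (w |: (v |: t))).
have antisym v w : v \notin t -> w \notin t -> v != w -> F v w = - F w v.
  move=> vt wt vw; rewrite /F !incU1_self !mulrA -mulNr setUCA; congr (_ * _).
  by rewrite mulrC [in RHS]mulrC (@inc_swap w v) // eq_sym.
rewrite (exchange_big_dep (fun w => w \notin t)) /=; last first.
  by move=> v w _; apply: contra => wt; rewrite inE wt orbT.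
(* The double sum is antisymmetric under exchange; ordering the two indices makes the
   cancellation valid in characteristic two as well. *)
have split w : w \notin t ->
    \sum_(v | (v \notin t) && (w \notin v |: t)) F v w =
    \sum_(v | (v \notin t) && (o v < o w)%N) F v w
    - \sum_(v | (v \notin t) && (o w < o v)%N) F w v.
  move=> wt; rewrite (bigID (fun v => (o v < o w)%N)) /=; congr (_ + _).
    apply: eq_bigl => v; rewrite !inE negb_or wt andbT.
    case: (v \in t) => //=; case: eqVneq => [->|] //=; first by rewrite ltnn.
  rewrite -sumrN; apply: eq_big => [v|v].
    rewrite !inE negb_or wt andbT -leqNgt leq_eqVlt (inj_eq o_inj).
    by case: (v \in t) => //=; case: eqVneq => //= ->; rewrite ltnn.
  rewrite !inE negb_or wt andbT => /andP[/andP[vt wv] _].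
  by rewrite antisym // eq_sym.
rewrite (eq_bigr _ split) sumrB.
rewrite [X in _ - X](exchange_big_dep (fun w => w \notin t)) /=; last by move=> v w _ /andP[].
apply/eqP; rewrite subr_eq0; apply/eqP; apply: eq_bigr => w wt.
by apply: eq_bigl => v; rewrite wt.
Qed.

Definition res W c : chain := [ffun s => if s \in W then c s else 0].

Fact res_is_linear W : linear (res W).
Proof.
by move=> x c c'; apply/ffunP => t; rewrite !ffunE; case: ifP; rewrite // scaler0 addr0.
Qed.

HB.instance Definition _ W := GRing.isLinear.Build k _ _ _ (res W) (res_is_linear W).

(** For a difference [W] of two simplicial complexes, this is the boundary of the relative
    chain complex of the pair. *)
Definition bdW W c : chain := res W (bdo c).

Fact bdW_is_linear W : linear (bdW W).
Proof. by move=> x c c'; rewrite /bdW !linearP. Qed.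

HB.instance Definition _ W := GRing.isLinear.Build k _ _ _ (bdW W) (bdW_is_linear W).

Definition bdl W : 'End(chain) := linfun (bdW W).

Definition hdim W j : nat :=
  (\dim (chains k W j :&: lker (bdl W)) - \dim (bdl W @: chains k W j.+1))%N.

Definition acyclic W := forall j, hdim W j = 0%N.

Lemma memchainsP W j c :
  reflect (forall s, c s != 0 -> s \in W /\ #|s| = j) (c \in chains k W j).
Proof.
pose X := [seq [ffun t => (t == s)%:R : k^o] : chain
  | s <- enum [set s in W | #|s| == j]].
apply: (iffP idP) => [|cP].
  move=> cX; have {cX} : c \in <<X>>%VS by [].
  move=> /(@coord_span _ _ _ (in_tuple X)) -> s.
  have [/andP[sW /eqP sj] //|nsW] := boolP ((s \in W) && (#|s| == j)).
  rewrite sum_ffunE big1 ?eqxx // => i _; rewrite !ffunE.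
  have : (in_tuple X)`_i \in X by rewrite mem_nth // -[X in (_ < X)%N](size_tuple (in_tuple X)).
  case/mapP => u; rewrite mem_enum inE => /andP[uW /eqP uj] ->; rewrite ffunE.
  case: eqVneq => [su|]; last by rewrite scaler0.
  by case/negP: nsW; rewrite su uW uj eqxx.
have -> : c = \sum_(s in [set s in W | #|s| == j]) c s *: ([ffun t => (t == s)%:R : k^o] : chain).
  apply/ffunP => t; rewrite sum_ffunE.
  have [tW|tW] := boolP (t \in [set s in W | #|s| == j]).
    rewrite (bigD1 t) //= !ffunE eqxx /GRing.scale /= mulr1 big1 ?addr0 // => s /andP[_ st].
    by rewrite !ffunE eq_sym (negbTE st) scaler0.
  rewrite big1 => [|s sW].
    apply/eqP; apply: contraNT tW => /cP[tW tj].
    by rewrite inE tW tj eqxx.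
  rewrite !ffunE; case: eqVneq => [ts|]; last by rewrite scaler0.
  by rewrite ts sW in tW.
apply: memv_suml => s sW; apply: memvZ; apply: memv_span.
by apply/mapP; exists s; rewrite ?mem_enum.
Qed.


Lemma memcycleP W j c :
  reflect (c \in chains k W j /\ bdW W c = 0) (c \in chains k W j :&: lker (bdl W))%VS.
Proof.
rewrite memv_cap memv_ker lfunE /=.
by apply: (iffP andP) => -[cW /eqP].
Qed.

Lemma memboundaryP W j c :
  reflect (exists2 e, e \in chains k W j.+1 & c = bdW W e)
          (c \in bdl W @: chains k W j.+1)%VS.
Proof. by apply: (iffP memv_imgP) => -[e eW ->]; exists e; rewrite ?lfunE. Qed.

Lemma bdo_neq0 c s : bdo c s != 0 -> exists2 v, v \notin s & c (v |: s) != 0.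
Proof.
move=> cs; case: (pickP (fun v => (v \notin s) && (c (v |: s) != 0))).
  by move=> v /andP[]; exists v.
move=> c0; case/eqP: cs; rewrite ffunE big1 // => v vs.
by have := c0 v; rewrite vs /= => /negbFE/eqP->; rewrite mulr0.
Qed.

Lemma bdo_card c j : (forall s, c s != 0 -> #|s| = j.+1) ->
  forall s, bdo c s != 0 -> #|s| = j.
Proof. by move=> cj s /bdo_neq0[v vs /cj]; rewrite cardsU1 vs => -[]. Qed.

Lemma bdW_chains W V j c : c \in chains k V j.+1 -> bdW W c \in chains k W j.
Proof.
move=> /memchainsP cV; apply/memchainsP => s; rewrite ffunE.
case: ifP => // sW; last by rewrite eqxx.
by move=> /(@bdo_card c j _ s)-> // u /cV[].
Qed.

Lemma bdW_chains0 W V c : c \in chains k V 0 -> bdW W c = 0.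
Proof.
move=> /memchainsP cV; apply/ffunP => s; rewrite !ffunE; case: ifP => // _.
by rewrite big1 // => v vs; have [->|/cV[_]] := eqVneq (c (v |: s)) 0;
  rewrite ?mulr0 // cardsU1 vs.
Qed.

Lemma chainsS W V j c : V \subset W -> c \in chains k V j -> c \in chains k W j.
Proof.
move=> /subsetP VW /memchainsP cV; apply/memchainsP => s /cV[sV sj].
by rewrite VW.
Qed.

Lemma res_chains W V j c : c \in chains k W j -> res V c \in chains k V j.
Proof.
move=> /memchainsP cW; apply/memchainsP => s; rewrite ffunE.
by case: ifP => [sV /cW[]|]; rewrite ?eqxx.
Qed.

Lemma res_id W j c : c \in chains k W j -> res W c = c.
Proof.
move=> /memchainsP cW; apply/ffunP => s; rewrite ffunE; case: ifPn => // sW.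
by apply/esym/eqP; apply: contraNT sW => /cW[].
Qed.

(** The differences of two simplicial complexes are the convex families; convexity is what
    makes [bdW W] a differential, see [bdWK]. *)
Definition convex W :=
  forall r s t, r \in W -> t \in W -> r \subset s -> s \subset t -> s \in W.

(** [V] carries a subcomplex of the chain complex of [W], with quotient carried by
    [W :\: V]. *)
Definition lower V W :=
  V \subset W /\ forall s t, s \in V -> t \in W -> t \subset s -> t \in V.

Lemma bdWK W j c : convex W -> c \in chains k W j -> bdW W (bdW W c) = 0.
Proof.
move=> cvx /memchainsP cW; apply/ffunP => t; rewrite ffunE [RHS]ffunE.
case: ifP => // tW; transitivity (bdo (bdo c) t); last by rewrite bdoK ffunE.
rewrite ffunE [RHS]ffunE; apply: eq_bigr => v vt; congr (_ * _); rewrite ffunE.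
case: ifPn => // vtW; apply/esym/eqP; apply: contraNT vtW => /bdo_neq0[w _ /cW[wvtW _]].
by apply: (cvx t _ _ tW wvtW); rewrite subsetUr.
Qed.

Lemma acyclicP W : convex W ->
  acyclic W <-> (forall j c, c \in chains k W j -> bdW W c = 0 ->
    exists2 e, e \in chains k W j.+1 & bdW W e = c).
Proof.
move=> cvx; split=> [acW j c cW c0|acW j].
  have sBZ : (bdl W @: chains k W j.+1 <= chains k W j :&: lker (bdl W))%VS.
    apply/subvP => _ /memboundaryP[e eW ->]; apply/memcycleP.
    by rewrite (bdW_chains _ eW) (bdWK cvx eW).
  have : c \in (chains k W j :&: lker (bdl W))%VS by apply/memcycleP.
  have /eqP <- : (bdl W @: chains k W j.+1 == chains k W j :&: lker (bdl W))%VS.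
    by rewrite eqEdim sBZ /= -subn_eq0; apply/eqP/acW.
  by case/memboundaryP=> e eW ->; exists e.
apply/eqP; rewrite subn_eq0 dimvS //; apply/subvP => c /memcycleP[cW c0].
by apply/memboundaryP; have [e eW <-] := acW j c cW c0; exists e.
Qed.

(** * Homology of a family split into a lower and an upper part *)

(** The chain complexes of [V], [W] and [U] form a short exact sequence.  The three lemmas
    [hdim_lower], [hdim_upper] and [hdim_shift] are the cases of its long exact homology
    sequence in which one of the three terms vanishes. *)
Section Corners.
Variables V W : {set {set T}}.
Hypotheses (cvxW : convex W) (lowVW : lower V W).

Let U := W :\: V.

Lemma convex_lower : convex V.
Proof.
have [/subsetP VW lowV] := lowVW; move=> r s t rV tV rs st.
exact: lowV tV (cvxW (VW _ rV) (VW _ tV) rs st) st.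
Qed.

Lemma convex_upper : convex U.
Proof.
have [/subsetP VW lowV] := lowVW; move=> r s t /setDP[rW rV] /setDP[tW _] rs st.
rewrite inE (cvxW rW tW rs st) andbT.
by apply: contra rV => sV; apply: lowV sV rW rs.
Qed.

Lemma bdW_lower j c : c \in chains k V j -> bdW W c = bdW V c.
Proof.
have [/subsetP VW lowV] := lowVW; move=> /memchainsP cV; apply/ffunP => s.
rewrite ffunE [RHS]ffunE; have [sV|sV] := boolP (s \in V); first by rewrite VW.
case: ifP => // sW; apply/eqP; apply: contraNT sV => /bdo_neq0[v vs /cV[vsV _]].
by apply: lowV vsV sW _; apply: subsetUr.
Qed.

Lemma bdW_upper j c : c \in chains k W j -> res U (bdW W c) = bdW U (res U c).
Proof.
have [/subsetP VW lowV] := lowVW; move=> /memchainsP cW; apply/ffunP => s.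
rewrite ffunE [RHS]ffunE; case: ifPn => // /setDP[sW sV].
rewrite ffunE sW !ffunE; apply: eq_bigr => v vs; rewrite ffunE.
case: ifPn => // vsU; congr (_ * _); apply/eqP; apply: contraNT vsU => /cW[vsW _].
by rewrite inE vsW andbT; apply: contra sV => vsV; apply: lowV vsV sW (subsetUr _ _).
Qed.

Lemma res_upper_eq0 j c : c \in chains k W j -> res U c = 0 -> c \in chains k V j.
Proof.
move=> /memchainsP cW /ffunP c0; apply/memchainsP => s cs.
have [sW sj] := cW _ cs; split=> //; apply: contraNT cs => sV.
by have := c0 s; rewrite !ffunE inE sV sW /= => ->.
Qed.

Lemma res_lower0 j c : c \in chains k V j -> res U c = 0.
Proof.
move=> /memchainsP cV; apply/ffunP => s; rewrite !ffunE inE.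
by case: ifP => // /andP[sV _]; apply/eqP; apply: contraNT sV => /cV[].
Qed.

Lemma upper_chains j c : c \in chains k U j -> c \in chains k W j.
Proof. exact/chainsS/subsetDl. Qed.

Lemma lower_chains j c : c \in chains k V j -> c \in chains k W j.
Proof. by apply: chainsS; case: lowVW. Qed.

(** If [U] is acyclic, subtracting a boundary removes the part of a chain outside [V],
    provided that this part is a cycle in the quotient. *)
Lemma push_to_lower j c : acyclic U -> c \in chains k W j -> bdW U (res U c) = 0 ->
  exists2 e, e \in chains k W j.+1 & c - bdW W e \in chains k V j.
Proof.
move=> /(acyclicP convex_upper) acU cW.
move=> /(acU _ _ (res_chains _ cW))[e eU eE].
have eW := upper_chains eU; exists e => //.
apply: res_upper_eq0; first by rewrite memvB // (bdW_chains _ eW).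
by rewrite linearB /= (bdW_upper eW) (res_id eU) eE subrr.
Qed.

Let boundary_cycle X (cvx : convex X) j :
  (bdl X @: chains k X j.+1 <= chains k X j :&: lker (bdl X))%VS.
Proof.
apply/subvP => _ /memboundaryP[e eX ->]; apply/memcycleP.
by rewrite (bdW_chains _ eX) (bdWK cvx eX).
Qed.

Lemma hdim_lower j : acyclic U -> hdim V j = hdim W j.
Proof.
move=> acU; apply: (dimv_quotient_eq (f := \1%VF)); try exact: boundary_cycle.
- exact/boundary_cycle/convex_lower.
- move=> c /memcycleP[cV c0]; rewrite id_lfunE; apply/memcycleP.
  by rewrite (lower_chains cV) (bdW_lower cV).
- move=> _ /memboundaryP[e eV ->]; rewrite id_lfunE; apply/memboundaryP.
  by exists e; rewrite ?(lower_chains eV) // (bdW_lower eV).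
- move=> c /memcycleP[cV c0]; rewrite id_lfunE => /memboundaryP[e eW cE].
  have [|f fW efV] := push_to_lower acU eW.
    by rewrite -(bdW_upper eW) -cE (res_lower0 cV).
  apply/memboundaryP; exists (e - bdW W f) => //.
  by rewrite -(bdW_lower efV) linearB /= (bdWK cvxW fW) subr0.
move=> c /memcycleP[cW c0]; have [|e eW ceV] := push_to_lower acU cW.
  by rewrite -(bdW_upper cW) c0 linear0.
exists (c - bdW W e).
  apply/memcycleP; split=> //.
  by rewrite -(bdW_lower ceV) linearB /= (bdWK cvxW eW) c0 subr0.
by rewrite id_lfunE opprB addrC subrK; apply/memboundaryP; exists e.
Qed.

Lemma hdim_upper j : acyclic V -> hdim W j = hdim U j.
Proof.
move=> /(acyclicP convex_lower) acV.
apply: (dimv_quotient_eq (f := linfun (res U))); try exact: boundary_cycle.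
- move=> c /memcycleP[cW c0]; rewrite lfunE /=; apply/memcycleP.
  by rewrite (res_chains _ cW) -(bdW_upper cW) c0 linear0.
- move=> _ /memboundaryP[e eW ->]; rewrite lfunE /=; apply/memboundaryP.
  by exists (res U e); rewrite ?(res_chains _ eW) // (bdW_upper eW).
- move=> c /memcycleP[cW c0]; rewrite lfunE /= => /memboundaryP[e eU cE].
  have eW := upper_chains eU.
  have ceV : c - bdW W e \in chains k V j.
    apply: res_upper_eq0; first by rewrite memvB // (bdW_chains _ eW).
    by rewrite linearB /= (bdW_upper eW) (res_id eU) cE subrr.
  have [|f fV fE] := acV _ _ ceV.
    by rewrite -(bdW_lower ceV) linearB /= c0 (bdWK cvxW eW) subr0.
  apply/memboundaryP; exists (f + e); first by rewrite memvD // lower_chains.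
  by rewrite linearD /= (bdW_lower fV) fE subrK.
- exact/boundary_cycle/convex_upper.
move=> c /memcycleP[cU c0]; have cW := upper_chains cU.
(* The boundary of [c] is a cycle on [V], hence bounds there; subtracting a bounding chain
   lifts [c] to a cycle of [W]. *)
have [e eV eE] : exists2 e, e \in chains k V j & bdW W e = bdW W c.
  case: j cU cW => [|j] cU cW.
    by exists 0; rewrite ?mem0v // linear0 (bdW_chains0 _ cW).
  have dcV : bdW W c \in chains k V j.
    apply: res_upper_eq0; first exact: bdW_chains cW.
    by rewrite (bdW_upper cW) (res_id cU).
  have [|e eV eE] := acV _ _ dcV; first by rewrite -(bdW_lower dcV) (bdWK cvxW cW).
  by exists e; rewrite ?(bdW_lower eV).
exists (c - e).
  by apply/memcycleP; rewrite memvB ?(lower_chains eV) // linearB /= eE subrr.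
by rewrite lfunE /= linearB /= (res_id cU) (res_lower0 eV) subr0 subrr mem0v.
Qed.

Lemma hdim_shift j : acyclic W -> hdim U j.+1 = hdim V j.
Proof.
move=> /(acyclicP cvxW) acW.
apply: (dimv_quotient_eq (f := bdl W)).
- exact/boundary_cycle/convex_upper.
- move=> c /memcycleP[cU c0]; rewrite lfunE /=; have cW := upper_chains cU.
  have dcV : bdW W c \in chains k V j.
    apply: res_upper_eq0; first exact: bdW_chains cW.
    by rewrite (bdW_upper cW) (res_id cU).
  by apply/memcycleP; rewrite dcV -(bdW_lower dcV) (bdWK cvxW cW).
- move=> _ /memboundaryP[e eU ->]; rewrite lfunE /=; have eW := upper_chains eU.
  have deV : bdW U e - bdW W e \in chains k V j.+1.
    apply: res_upper_eq0.
      by rewrite memvB ?(bdW_chains _ eW) // (upper_chains (bdW_chains _ eW)).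
    rewrite linearB /= (bdW_upper eW) (res_id eU).
    by rewrite (res_id (bdW_chains _ eU)) subrr.
  apply/memboundaryP; exists (bdW U e - bdW W e) => //; rewrite -(bdW_lower deV).
  by rewrite linearB /= (bdWK cvxW eW) subr0.
- move=> c /memcycleP[cU c0]; rewrite lfunE /= => /memboundaryP[e eV cE].
  have cW := upper_chains cU.
  have [||f fW fE] := acW j.+1 (c - e); first by rewrite memvB // lower_chains.
    by rewrite linearB /= (bdW_lower eV) cE subrr.
  apply/memboundaryP; exists (res U f); first exact: res_chains fW.
  by rewrite -(bdW_upper fW) fE linearB /= (res_id cU) (res_lower0 eV) subr0.
- exact/boundary_cycle/convex_lower.
move=> c /memcycleP[cV c0].
have [||e eW eE] := acW j c; rewrite ?lower_chains ?(bdW_lower cV) //.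
have reU := res_chains U eW; exists (res U e).
  by apply/memcycleP; rewrite reU -(bdW_upper eW) eE (res_lower0 cV).
have erV : e - res U e \in chains k V j.+1.
  apply: res_upper_eq0; first by rewrite memvB // (upper_chains reU).
  by rewrite linearB /= (res_id reU) subrr.
rewrite lfunE /=; apply/memboundaryP; exists (e - res U e) => //.
by rewrite -(bdW_lower erV) linearB /= eE.
Qed.

End Corners.

(** * Cones and fibrations *)

(** Joining with the apex [v] is a contracting homotopy; it keeps chains in [W] because [W] is
    stable under adding and removing [v]. *)
Lemma acyclic_cone W v : convex W ->
  (forall s, s \in W -> v |: s \in W /\ s :\ v \in W) -> acyclic W.
Proof.
move=> cvxW stable; apply/(acyclicP cvxW) => j c cW c0.
pose h : chain := [ffun s : {set T} => if v \in s then (-1) ^+ inc v s * c (s :\ v) : k^o else 0].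
exists h.
  apply/memchainsP => s; rewrite ffunE; case: ifP => vs; last by rewrite eqxx.
  have [->|/(elimT (memchainsP _ _ _) cW)[sW <-] _] := eqVneq (c (s :\ v)) 0.
    by rewrite mulr0 eqxx.
  split; last by rewrite [LHS](cardsD1 v) vs.
  by rewrite -(setD1K vs); case: (stable _ sW).
apply/ffunP => t; rewrite ffunE; case: ifPn => [tW|tW]; last first.
  by apply/esym/eqP; apply: contraNT tW => /(elimT (memchainsP _ _ _) cW)[].
have [vt|vt] := boolP (v \in t).
  have [u vu tE] : exists2 u : {set T}, v \notin u & t = v |: u.
    by exists (t :\ v); rewrite ?setD11 ?setD1K.
  have uW : u \in W by have [_] := stable t tW; rewrite tE setU1K.
  have : bdW W c u = 0 by rewrite c0 ffunE.
  rewrite ffunE uW ffunE (bigD1 v) //= incU1_self => /eqP.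
  rewrite addrC addr_eq0 => /eqP sumE.
  have -> : bdo h t = \sum_(w | (w \notin u) && (w != v))
     - (-1) ^+ inc v u * ((-1) ^+ inc w (w |: u) * c (w |: u)).
    rewrite ffunE; apply: eq_big => [w|w]; first by rewrite tE !inE negb_or andbC.
    rewrite tE !inE negb_or => /andP[wv wu].
    rewrite ffunE !inE eqxx orbT setUCA setU1K ?inE ?negb_or 1?eq_sym ?wv // !mulrA.
    congr (_ * _); rewrite incU1_self [v |: _]setUCA !incU1_self.
    have vw : v != w by rewrite eq_sym.
    apply: (mulIf (negbT (signr_eq0 k (inc w u)))); rewrite -mulrA (inc_swap vw vu wu).
    by rewrite mulrN mulrA -expr2 sqrr_sign mul1r -mulrA -expr2 sqrr_sign mulr1.
  by rewrite -mulr_sumr sumE mulrNN mulrA -expr2 sqrr_sign mul1r tE.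
rewrite ffunE (bigD1 v) //= big1 ?addr0 => [|w /andP[wt wv]].
  by rewrite ffunE setU11 setU1K // mulrA -expr2 sqrr_sign mul1r.
by rewrite ffunE !inE eq_sym (negbTE wv) (negbTE vt) mulr0.
Qed.

Lemma acyclic0 : acyclic set0.
Proof.
apply/acyclicP => [? ? ?|j c cW _]; first by rewrite inE.
exists 0; rewrite ?mem0v // linear0; apply/esym/ffunP => s; rewrite ffunE.
by apply/eqP; apply: contraTT cW => cs; apply/memchainsP => /(_ s cs); rewrite inE => -[].
Qed.

(** The first page of the spectral sequence of the filtration by [rk \o rho] is made of the
    homology of the fibres.  Concretely, a fibre of maximal rank is closed upwards in [W],
    so it can be split off and the others are handled by induction. *)
Lemma acyclic_fibration (X : eqType) (rho : {set T} -> X) (rk : X -> nat) W :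
    convex W ->
    (forall s t, s \in W -> t \in W -> t \subset s ->
      rho t = rho s \/ (rk (rho t) < rk (rho s))%N) ->
    (forall x, acyclic [set s in W | rho s == x]) ->
  acyclic W.
Proof.
have [N] := ubnP #|W|; elim: N W => // N IHN W leWN cvxW mono fib.
case: (set_0Vmem W) => [->|[s0' s0W']]; first exact: acyclic0.
case: (arg_maxnP (fun s => rk (rho s)) s0W') => s0 s0W maxs0 {s0' s0W'}.
pose V := [set s in W | rho s != rho s0].
have lowVW : lower V W.
  split=> [|s t]; first by apply/subsetP => s /setIdP[].
  rewrite !inE => /andP[sW ss0] tW st; rewrite tW /=.
  case: (mono s t sW tW st) => [->//|lt_ts].
  by apply: contraTneq lt_ts => ->; rewrite -leqNgt; apply: maxs0.
have fibV x : [set s in V | rho s == x] =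
    if x == rho s0 then set0 else [set s in W | rho s == x].
  apply/setP => s; rewrite !inE; case: (eqVneq x (rho s0)) => [->|xs0].
    by rewrite inE -andbA andNb andbF.
  by rewrite inE -andbA; case: (eqVneq (rho s) x) => [->|]; rewrite ?andbF ?xs0.
have acV : acyclic V.
  apply: IHN.
  - rewrite -ltnS; apply: leq_trans leWN; rewrite ltnS; apply: proper_card.
    by rewrite properE lowVW.1; apply/subsetPn; exists s0; rewrite // !inE eqxx andbF.
  - exact: convex_lower lowVW.
  - by move=> s t /setIdP[sW _] /setIdP[tW _]; apply: mono.
  by move=> x; rewrite fibV; case: ifP => _; [apply: acyclic0 | apply: fib].
move=> j; rewrite (hdim_upper cvxW lowVW) //.
rewrite (_ : W :\: V = [set s in W | rho s == rho s0]); first exact: fib.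
by apply/setP => s; rewrite !inE; case: (s \in W); rewrite ?andbF //= negbK andbT.
Qed.

Lemma hdim_set1 s j : hdim [set s] j = (j == #|s|).
Proof.
pose d : chain := [ffun t => (t == s)%:R].
have bd0 c i : c \in chains k [set s] i -> bdW [set s] c = 0.
  move=> /memchainsP cs; apply/ffunP => t; rewrite !ffunE inE.
  case: eqVneq => // ->; rewrite big1 // => v vs.
  have [->|/cs[]] := eqVneq (c (v |: s)) 0; first by rewrite mulr0.
  by rewrite inE => /eqP vsE; rewrite -vsE setU11 in vs.
have chainsE i : chains k [set s] i = (if i == #|s| then <[d]> else 0)%VS.
  apply/eqP; rewrite eqEsubv; apply/andP; split; apply/subvP => c.
    move=> /memchainsP cs; suff -> : c = if i == #|s| then c s *: d else 0.
      by case: ifP; rewrite ?memvZ ?memv_line ?mem0v.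
    apply/ffunP => t; have [/cs[/set1P-> <-]|] := boolP (c t != 0).
      by rewrite eqxx !ffunE eqxx /GRing.scale /= mulr1.
    rewrite negbK => /eqP ct; rewrite ct; case: ifP => _; rewrite !ffunE //.
    by case: (eqVneq t s) ct => [-> ->|_ _]; rewrite ?scale0r ?scaler0.
  case: eqVneq => [->|_]; last by rewrite memv0 => /eqP->; apply: mem0v.
  case/vlineP => x ->; apply: memvZ; apply/memchainsP => t; rewrite ffunE.
  by case: (eqVneq t s) => [->|]; rewrite ?set11 ?eqxx.
have d0 : d != 0.
  by apply/eqP => /ffunP/(_ s)/eqP; rewrite !ffunE eqxx oner_eq0.
rewrite /hdim (_ : _ :&: _ = chains k [set s] j)%VS; last first.
  by apply/capv_idPl; apply/subvP => c /bd0 c0;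
    rewrite memv_ker lfunE /= c0.
rewrite (_ : (_ @: _) = 0)%VS; last first.
  apply/eqP; rewrite -subv0; apply/subvP => _ /memboundaryP[e eW ->].
  by rewrite (bd0 _ _ eW) mem0v.
by rewrite dimv0 subn0 chainsE; case: eqP; rewrite ?dimv0 // dim_vline d0.
Qed.

End Homology.

(** * Change of vertices *)

Lemma inc_transport (T T' : finType) (o : T -> nat) (o' : T' -> nat)
    (f : T -> T') (v : T) (s : {set T}) :
    injective f -> (forall x y, (o' (f x) < o' (f y))%N = (o x < o y)%N) ->
  inc o' (f v) (f @: s) = inc o v s.
Proof.
move=> f_inj of_; rewrite /inc -[RHS](card_imset _ f_inj); apply: eq_card => y.
rewrite inE; apply/andP/imsetP => [[/imsetP[x xs ->]]|[x]].
  by rewrite of_ => xv; exists x; rewrite // inE xs.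
by rewrite inE => /andP[xs xv] ->; rewrite imset_f // of_.
Qed.

Lemma hdim_transport (k : fieldType) (T T' : finType) (o : T -> nat) (o' : T' -> nat)
    (f : T -> T') (W : {set {set T}}) j :
    injective o -> injective o' -> injective f ->
    (forall x y, (o' (f x) < o' (f y))%N = (o x < o y)%N) ->
    convex W -> convex [set f @: (s : {set T}) | s in W] ->
  hdim k o' [set f @: (s : {set T}) | s in W] j = hdim k o W j.
Proof.
move=> o_inj o'_inj f_inj of_ cvxW cvxW'.
set W' := [set f @: _ | _ in W].
have fs_inj := imset_inj f_inj.
have memW' (s : {set T}) : (f @: s \in W') = (s \in W) by rewrite mem_imset.
pose psi (c : {ffun {set T'} -> k^o}) : {ffun {set T} -> k^o} := [ffun s : {set T} => c (f @: s)].
have psi_lin : linear psi by move=> x c c'; apply/ffunP => s; rewrite !ffunE.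
pose Mpsi := GRing.isLinear.Build k _ _ _ psi psi_lin.
pose Lpsi : {linear _ -> _} := HB.pack psi Mpsi.
pose ext (c : {ffun {set T} -> k^o}) : {ffun {set T'} -> k^o} :=
  [ffun s' : {set T'} => if s' \in W' then c (f @^-1: s') else 0].
have preK (s : {set T}) : f @^-1: (f @: s) = s.
  by apply/setP => x; rewrite inE mem_imset.
have psi_chains i c : c \in chains k W' i -> psi c \in chains k W i.
  move=> /memchainsP cW; apply/memchainsP => s; rewrite ffunE => /cW[].
  by rewrite memW' (card_imset _ f_inj).
have ext_chains i c : c \in chains k W i -> ext c \in chains k W' i.
  move=> /memchainsP cW; apply/memchainsP => s'; rewrite ffunE.
  case: ifP; rewrite ?eqxx // => /imsetP[s sW ->].
  by rewrite preK (card_imset _ f_inj) => /cW[].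
have extK i c : c \in chains k W i -> psi (ext c) = c.
  move=> /memchainsP cW; apply/ffunP => s; rewrite !ffunE memW' preK.
  by case: ifPn => // sW; apply/esym/eqP; apply: contraNT sW => /cW[].
have psi_inj i c : c \in chains k W' i -> psi c = 0 -> c = 0.
  move=> /memchainsP cW /ffunP c0; apply/ffunP => s'; rewrite ffunE.
  apply/eqP/idPn => cs'; have [/imsetP[s sW sE] _] := cW _ cs'.
  by have := c0 s; rewrite !ffunE -sE => /eqP; rewrite (negbTE cs').
have psi_bd i c : c \in chains k W' i -> psi (bdW o' W' c) = bdW o W (psi c).
  move=> /memchainsP cW; apply/ffunP => s; rewrite !ffunE memW'.
  case: ifP => // sW.
  rewrite (bigID (mem (codom f))) /= [X in _ + X]big1 ?addr0 => [|v' /andP[v's v'f]].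
    rewrite (reindex_omap f (fun v' => [pick v | f v == v'])) /=.
      apply: eq_big => [v|v /andP[/andP[vs _] _]].
        rewrite mem_imset // codom_f andbT; case: pickP => [w /eqP/f_inj->|/(_ v)].
          by rewrite eqxx andbT.
        by rewrite eqxx.
      by rewrite ffunE -imsetU1 (inc_transport _ _ f_inj of_).
    move=> _ /andP[_ /codomP[v ->]].
    by case: pickP => [w /eqP/= ->|/(_ v)]; rewrite ?eqxx.
  have [->|/cW[/imsetP[u uW uE]]] := eqVneq (c (v' |: f @: s)) 0; first by rewrite mulr0.
  case/negP: v'f; have : v' \in f @: u by rewrite -uE setU11.
  by case/imsetP => x _ ->; apply: codom_f.
have bdry (S : finType) (p : S -> nat) X (p_inj : injective p) (cvxX : convex X) i :
    (bdl k p X @: chains k X i.+1 <= chains k X i :&: lker (bdl k p X))%VS.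
  apply/subvP => _ /memboundaryP[e eX ->]; apply/memcycleP.
  by rewrite (bdW_chains _ _ eX) (bdWK p_inj cvxX eX).
apply: (dimv_quotient_eq (f := linfun Lpsi)); try exact: bdry.
- move=> c /memcycleP[cW c0]; rewrite lfunE /=; apply/memcycleP.
  by rewrite psi_chains // -(psi_bd _ _ cW) c0; split=> //; apply/ffunP => s; rewrite !ffunE.
- move=> _ /memboundaryP[e eW ->]; rewrite lfunE /=; apply/memboundaryP.
  by exists (psi e); rewrite ?psi_chains // (psi_bd _ _ eW).
- move=> c /memcycleP[cW c0]; rewrite lfunE /= => /memboundaryP[e eW cE].
  have eW' := ext_chains _ _ eW.
  apply/memboundaryP; exists (ext e) => //; apply/eqP; rewrite -subr_eq0; apply/eqP.
  apply: (psi_inj j); first by rewrite memvB // (bdW_chains _ _ eW').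
  rewrite -[psi _]/(Lpsi _) linearB /=.
  by rewrite (psi_bd _ _ eW') (extK _ _ eW) cE subrr.
move=> c /memcycleP[cW c0]; have cW' := ext_chains _ _ cW; exists (ext c).
  apply/memcycleP; split=> //.
  case: j cW cW' => [|j] cW cW'; first by rewrite (bdW_chains0 _ _ cW').
  apply: (psi_inj j); first exact: bdW_chains cW'.
  by rewrite (psi_bd _ _ cW') (extK _ _ cW).
by rewrite lfunE /= (extK _ _ cW) subrr mem0v.
Qed.

(** * Betti numbers as the homology of sets of atoms with a given join *)

Lemma convex_fiber (T X : finType) (rho : {set T} -> {set X}) (W : {set {set T}}) x :
    (forall s t : {set T}, t \subset s -> rho t \subset rho s) ->
  convex W -> convex [set s in W | rho s == x].
Proof.
move=> mono cvxW r s t /setIdP[rW /eqP rx] /setIdP[tW /eqP tx] rs st.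
rewrite inE (cvxW r s t rW tW rs st) eqEsubset /=; apply/andP.
by split; [rewrite -tx | rewrite -rx]; apply: mono.
Qed.

Lemma acyclic_set_fibration (T X : finType) (k : fieldType) (o : T -> nat)
    (rho : {set T} -> {set X}) (W : {set {set T}}) :
    injective o -> convex W ->
    (forall s t : {set T}, t \subset s -> rho t \subset rho s) ->
    (forall x, acyclic k o [set s in W | rho s == x]) ->
  acyclic k o W.
Proof.
move=> o_inj cvxW mono.
apply: (@acyclic_fibration _ _ _ o_inj _ rho (fun x : {set X} => #|x|)) => //.
move=> s t sW tW ts; have [le_ts eq_ts] := subset_leqif_cards (mono s t ts).
have [/eqP|] := eqVneq (rho t) (rho s); first by move/eqP; left.
by rewrite -eq_ts ltn_neqAle le_ts andbT; right.
Qed.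

Definition erank (T : finType) (v : T) : nat := enum_rank v.

Lemma erank_inj (T : finType) : injective (@erank T).
Proof. by move=> v w /val_inj/enum_rank_inj. Qed.

Definition closed_down (T : finType) (D : {set {set T}}) :=
  forall s t : {set T}, s \in D -> t \subset s -> t \in D.

Lemma convex_closed_down (T : finType) (D : {set {set T}}) : closed_down D -> convex D.
Proof. by move=> Ddown r s t _ tD _; apply: Ddown. Qed.

Lemma bdW_closed_down (T : finType) (k : fieldType) (o : T -> nat) (D : {set {set T}})
    j (c : {ffun {set T} -> k^o}) :
  closed_down D -> c \in chains k D j -> bdW o D c = bdo o c.
Proof.
move=> Ddown /memchainsP cD; apply/ffunP => s; rewrite ffunE.
case: ifPn => // sD; apply/esym/eqP; apply: contraNT sD => /bdo_neq0[v _ /cD[vsD _]].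
exact: Ddown vsD (subsetUr _ _).
Qed.

Lemma redH_dimE (T : finType) (k : fieldType) (D : {set {set T}}) j :
  closed_down D -> redH_dim k D j = hdim k (@erank T) D j.
Proof.
move=> Ddown; rewrite /redH_dim /hdim.
have bdE i c : c \in chains k D i -> bd T k c = bdl k (@erank T) D c.
  by move=> cD; rewrite !lfunE /= (bdW_closed_down _ Ddown cD).
congr (_ - _)%N.
  congr (\dim _); apply/eqP; rewrite eqEsubv; apply/andP; split;
    by apply/subvP => c; rewrite !memv_cap !memv_ker => /andP[cD];
      rewrite cD (bdE _ _ cD).
congr (\dim _); apply/eqP; rewrite eqEsubv; apply/andP; split;
  by apply/subvP => _ /memv_imgP[e eD ->]; apply/memv_imgP; exists e; rewrite ?(bdE _ _ eD).
Qed.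

Section LatticeHomology.
Local Open Scope order_scope.
Variables (k : fieldType) (d : Order.disp_t) (L : finTBLatticeType d).
Variables (n : nat) (a : 'I_n -> L).
Hypothesis atomicL : atomic_lattice a.

Local Notation jn s := (\join_(i in s) a i).
Implicit Types (s t : {set 'I_n}) (p x y : L).

Lemma atom_gt0 i : \bot < a i.
Proof. by case: atomicL => _ /(_ (a i))[_ atomP] _; apply: (proj1 (atomP _)); exists i. Qed.

Lemma jn_leP s x : reflect (forall i, i \in s -> a i <= x) (jn s <= x).
Proof. exact: joinsP. Qed.

Lemma le_jn (s : {set 'I_n}) i : i \in s -> a i <= jn s.
Proof. by move: i; apply/jn_leP. Qed.

Lemma jn_mono (s t : {set 'I_n}) : t \subset s -> jn t <= jn s.
Proof. by move/subsetP => ts; apply/jn_leP => i /ts; apply: le_jn. Qed.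

Lemma jn_set0 : jn set0 = \bot.
Proof. by apply/le_anti; rewrite le0x andbT; apply/jn_leP => i; rewrite inE. Qed.

Lemma jn_eq0 s : (jn s == \bot) = (s == set0).
Proof.
apply/eqP/eqP => [s0|->]; last exact: jn_set0.
apply/setP => i; rewrite inE; apply: contraTF (atom_gt0 i) => /le_jn.
by rewrite s0 lex0 => /eqP->; rewrite ltxx.
Qed.

Lemma exists_jn x : exists s, jn s = x.
Proof.
case: atomicL => _ _ /(_ x) atomicx; have [->|/atomicx[s ->]] := eqVneq x \bot.
  by exists set0; apply: jn_set0.
by exists s.
Qed.

Lemma exists_atom x : x != \bot -> exists i, a i <= x.
Proof.
have [s <-] := exists_jn x; rewrite jn_eq0 => /set0Pn[i is_]; exists i.
exact: le_jn.
Qed.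

Lemma jn_setU1_le i (s : {set 'I_n}) x : (jn (i |: s) <= x) = (a i <= x) && (jn s <= x).
Proof.
apply/jn_leP/andP => [le_x|[le_i /jn_leP le_s] j].
  split; first by rewrite le_x ?setU11.
  by apply/jn_leP => j js; rewrite le_x // inE js orbT.
by case/setU1P => [->//|/le_s].
Qed.

Definition below p : {set {set 'I_n}} := [set s : {set 'I_n} | jn s < p].
Definition upto p : {set {set 'I_n}} := [set s : {set 'I_n} | jn s <= p].

Lemma below_down p : closed_down (below p).
Proof. by move=> s t; rewrite !inE => sp /jn_mono ts; apply: le_lt_trans ts sp. Qed.

Lemma upto_down p : closed_down (upto p).
Proof. by move=> s t; rewrite !inE => sp /jn_mono ts; apply: le_trans ts sp. Qed.

(** Any atom below [p] is the apex of a cone. *)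
Lemma acyclic_upto p : p != \bot -> acyclic k (@erank 'I_n) (upto p).
Proof.
move=> /exists_atom[i ip]; apply: (@acyclic_cone _ _ _ (@erank_inj _) _ i).
  exact/convex_closed_down/upto_down.
move=> s sp; split; last exact: upto_down sp (subD1set _ _).
by move: sp; rewrite !inE jn_setU1_le ip.
Qed.

Lemma order_complex_down p : closed_down (order_complex p).
Proof.
move=> C D; rewrite !inE => /andP[/forall_inP inC /forall_inP cmpC] /subsetP DC.
apply/andP; split; first by apply/forall_inP => x /DC/inC.
apply/forall_inP => x /DC xC; apply/forall_inP => y /DC yC.
exact: (forall_inP (cmpC x xC)).
Qed.

Definition lpart (F : {set L + 'I_n}) : {set L} := [set x | inl x \in F].
Definition rpart (F : {set L + 'I_n}) : {set 'I_n} := [set i | inr i \in F].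

Lemma lpart_mono (F G : {set L + 'I_n}) : G \subset F -> lpart G \subset lpart F.
Proof. by move=> /subsetP GF; apply/subsetP => x; rewrite !inE => /GF. Qed.

Lemma rpart_mono (F G : {set L + 'I_n}) : G \subset F -> rpart G \subset rpart F.
Proof. by move=> /subsetP GF; apply/subsetP => x; rewrite !inE => /GF. Qed.

Lemma part_eq F : F = (inl @: lpart F) :|: (inr @: rpart F).
Proof.
apply/setP => -[x|i]; rewrite inE; apply/idP/orP.
- by move=> xF; left; rewrite imset_f ?inE.
- by case=> /imsetP[y]; rewrite inE => ? [] // ->.
- by move=> iF; right; rewrite imset_f ?inE.
- by case=> /imsetP[y]; rewrite inE => ? [] // ->.
Qed.

Lemma lpartU1l x F : lpart (inl x |: F) = x |: lpart F.
Proof. by apply/setP => y; rewrite !inE. Qed.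
Lemma rpartU1l x F : rpart (inl x |: F) = rpart F.
Proof. by apply/setP => y; rewrite !inE. Qed.
Lemma rpartD1l x F : rpart (F :\ inl x) = rpart F.
Proof. by apply/setP => y; rewrite !inE. Qed.
Lemma lpartU1r i F : lpart (inr i |: F) = lpart F.
Proof. by apply/setP => y; rewrite !inE. Qed.
Lemma rpartU1r i F : rpart (inr i |: F) = i |: rpart F.
Proof. by apply/setP => y; rewrite !inE. Qed.
Lemma lpartD1r i F : lpart (F :\ inr i) = lpart F.
Proof. by apply/setP => y; rewrite !inE. Qed.
Lemma lpart_inl (C : {set L}) : lpart (inl @: C) = C.
Proof. by apply/setP => x; rewrite inE mem_imset // => ? ? []. Qed.
Lemma rpart_inr s : rpart (inr @: s) = s.
Proof. by apply/setP => x; rewrite inE mem_imset // => ? ? []. Qed.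
Lemma lpart_inr s : lpart (inr @: s) = set0.
Proof. by apply/setP => x; rewrite !inE; apply/imsetP => -[]. Qed.
Lemma rpart_inl (C : {set L}) : rpart (inl @: C) = set0.
Proof. by apply/setP => x; rewrite !inE; apply/imsetP => -[]. Qed.

(** A mapping cylinder for the crosscut theorem: a face consists of a chain [C] in the open
    interval below [p] and a set of atoms lying below all of [C].  The faces without atoms form
    the order complex, those with an empty chain form [below p]. *)
Definition cylinder p : {set {set L + 'I_n}} :=
  [set F | [&& lpart F \in order_complex p, jn (rpart F) < p
             & [forall x in lpart F, jn (rpart F) <= x]]].

Lemma cylinderP p F :
  reflect [/\ lpart F \in order_complex p, jn (rpart F) < p
            & forall x, x \in lpart F -> jn (rpart F) <= x] (F \in cylinder p).
Proof.
by rewrite [F \in _]inE; apply: (iffP and3P) => -[? ? /forall_inP ?]; split=> //; apply/forall_inP.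
Qed.

Lemma cylinder_down p : closed_down (cylinder p).
Proof.
move=> F G /cylinderP[FC Fp le_F] GF; have le_GF := jn_mono (rpart_mono GF).
apply/cylinderP; split.
- exact: order_complex_down FC (lpart_mono GF).
- exact: le_lt_trans le_GF Fp.
by move=> x /(subsetP (lpart_mono GF))/le_F; apply: le_trans.
Qed.

Definition sum_rank (u : L + 'I_n) : nat :=
  match u with inl x => erank x | inr i => (#|L| + erank i)%N end.

Lemma sum_rank_inj : injective sum_rank.
Proof.
have lt_rank (x : L) : (erank x < #|L|)%N by rewrite /erank.
case=> [x|i] [y|j] /=; first by move=> /erank_inj->.
- by move=> E; have := lt_rank x; rewrite E ltnNge leq_addr.
- by move=> E; have := lt_rank y; rewrite -E ltnNge leq_addr.
by move/addnI/erank_inj->.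
Qed.

Lemma order_complexP p (C : {set L}) :
  reflect ((forall x, x \in C -> \bot < x < p) /\
           (forall x y, x \in C -> y \in C -> x >=< y)) (C \in order_complex p).
Proof.
rewrite inE; apply: (iffP andP) => -[inC cmpC]; split.
- exact/forall_inP.
- by move=> x y xC yC; apply: (forall_inP (forall_inP cmpC x xC)).
- exact/forall_inP.
by apply/forall_inP => x xC; apply/forall_inP => y; apply: cmpC.
Qed.

Section Crosscut.
Variable p : L.
Hypothesis p_neq0 : p != \bot.

Let cvxJ := convex_closed_down (@cylinder_down p).
Let Delta := [set (@inl L 'I_n) @: (C : {set L}) | C in order_complex p].
Let K := [set (@inr L 'I_n) @: (s : {set 'I_n}) | s in below p].

Let mem_Delta F : (F \in Delta) = (F \in cylinder p) && (rpart F == set0).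
Proof.
apply/imsetP/andP => [[C CP ->]|[/cylinderP[FP _ _] /eqP F0]]; last first.
  by exists (lpart F); rewrite // [LHS]part_eq F0 imset0 setU0.
rewrite rpart_inl eqxx; split=> //; apply/cylinderP; rewrite lpart_inl rpart_inl jn_set0.
by split; rewrite ?lt0x // => x _; apply: le0x.
Qed.

Let mem_K F : (F \in K) = (F \in cylinder p) && (lpart F == set0).
Proof.
apply/imsetP/andP => [[s sp ->]|[/cylinderP[_ FP _] /eqP F0]]; last first.
  by exists (rpart F); rewrite ?inE // [LHS]part_eq F0 imset0 set0U.
rewrite lpart_inr eqxx; split=> //; apply/cylinderP; rewrite lpart_inr rpart_inr.
split=> [||x]; rewrite ?inE // ?in_set0 // in sp *.
by apply/andP; split; apply/forall_inP => x; rewrite inE.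
Qed.

Let lowDelta : lower Delta (cylinder p).
Proof.
split; first by apply/subsetP => F; rewrite mem_Delta => /andP[].
move=> F G; rewrite !mem_Delta => /andP[_ /eqP F0] -> /rpart_mono.
by rewrite F0 subset0.
Qed.

Let lowK : lower K (cylinder p).
Proof.
split; first by apply/subsetP => F; rewrite mem_K => /andP[].
move=> F G; rewrite !mem_K => /andP[_ /eqP F0] -> /lpart_mono.
by rewrite F0 subset0.
Qed.

(** Fix the nonempty set of atoms of a face: its join lies in the open interval and below
    the whole chain, so it can be added to or removed from the chain. *)
Lemma acyclic_cylinder_over_order_complex : acyclic k sum_rank (cylinder p :\: Delta).
Proof.
have cvx := convex_upper cvxJ lowDelta.
apply: (acyclic_set_fibration sum_rank_inj cvx rpart_mono) => s.
have memW F : (F \in [set F in cylinder p :\: Delta | rpart F == s]) =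
    [&& s != set0, F \in cylinder p & rpart F == s].
  rewrite 2!inE mem_Delta andbC; have [->|] := eqVneq (rpart F) s; rewrite ?andbF ?andbT //=.
  by case: (F \in _); rewrite ?andbF ?andbT.
have [s0|s_neq0] := boolP (s == set0).
  suff -> : [set F in cylinder p :\: Delta | rpart F == s] = set0.
    exact: acyclic0 sum_rank_inj.
  by apply/setP => F; rewrite memW s0 in_set0.
apply: (@acyclic_cone _ _ _ sum_rank_inj _ (inl (jn s))).
  exact: convex_fiber rpart_mono cvx.
move=> F; rewrite !memW s_neq0 /= rpartU1l rpartD1l => /andP[FJ /eqP Fs].
rewrite Fs eqxx !andbT; split; last exact: cylinder_down FJ (subD1set _ _).
case/cylinderP: FJ; rewrite Fs => /order_complexP[inF cmpF] sp le_F.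
apply/cylinderP; rewrite rpartU1l lpartU1l Fs; split=> //; last first.
  by move=> x /setU1P[->//|/le_F].
apply/order_complexP; split=> [x /setU1P[->|/inF//]|x y].
  by rewrite sp lt0x jn_eq0 s_neq0.
case/setU1P=> [->|xF]; case/setU1P=> [->|yF].
- exact: comparablexx.
- exact/le_comparable/le_F.
- exact/ge_comparable/le_F.
exact: cmpF.
Qed.

(* A nonempty chain has a least element, which is not the bottom. *)
Let chain_has_lower_atom (C : {set L}) : C \in order_complex p -> C != set0 ->
  exists i, forall x, x \in C -> a i <= x.
Proof.
move=> /order_complexP[inC cmpC] /set0Pn[x0 x0C].
case: (arg_minnP (fun x => #|[set y | y <= x]|) x0C) => m mC min_m.
have [i im] : exists i, a i <= m.
  by apply: exists_atom; rewrite -lt0x; case/andP: (inC m mC).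
exists i => x xC; apply: le_trans im _; have := cmpC m x mC xC.
rewrite /Order.comparable => /orP[//|le_xm]; rewrite le_eqVlt; apply/orP; left.
apply/eqP/le_anti; rewrite le_xm andbT.
have : m \in [set y | y <= x].
  suff -> : [set y | y <= x] = [set y | y <= m] by rewrite inE.
  apply/eqP; rewrite eqEcard min_m // andbT; apply/subsetP => y; rewrite !inE => yx.
  exact: le_trans yx le_xm.
by rewrite inE.
Qed.

(** Fix the nonempty chain of a face: an atom below its least element can be added to or
    removed from the set of atoms. *)
Lemma acyclic_cylinder_over_below : acyclic k sum_rank (cylinder p :\: K).
Proof.
have cvx := convex_upper cvxJ lowK.
apply: (acyclic_set_fibration sum_rank_inj cvx lpart_mono) => C.
have memW F : (F \in [set F in cylinder p :\: K | lpart F == C]) =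
    [&& C != set0, F \in cylinder p & lpart F == C].
  rewrite 2!inE mem_K andbC; have [->|] := eqVneq (lpart F) C; rewrite ?andbF ?andbT //=.
  by case: (F \in _); rewrite ?andbF ?andbT.
have [emptyW|[F0]] := set_0Vmem [set F in cylinder p :\: K | lpart F == C].
  by rewrite emptyW; exact: acyclic0 sum_rank_inj.
rewrite memW => /and3P[C_neq0 /cylinderP[F0C _ _] /eqP F0E]; rewrite F0E in F0C.
have [i iC] := chain_has_lower_atom F0C C_neq0.
apply: (@acyclic_cone _ _ _ sum_rank_inj _ (inr i)).
  exact: convex_fiber lpart_mono cvx.
move=> F; rewrite !memW C_neq0 /= lpartU1r lpartD1r => /andP[FJ /eqP FC].
rewrite FC eqxx !andbT; split; last exact: cylinder_down FJ (subD1set _ _).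
case/cylinderP: FJ; rewrite FC => _ Fp le_F.
have le_iF x : x \in C -> jn (i |: rpart F) <= x by move=> xC; rewrite jn_setU1_le iC ?le_F.
apply/cylinderP; rewrite rpartU1r lpartU1r FC; split=> //.
have /set0Pn[x xC] := C_neq0; apply: le_lt_trans (le_iF x xC) _.
by case/order_complexP: F0C => /(_ x xC)/andP[].
Qed.

(** The crosscut theorem: both complexes are obtained from the cylinder by discarding an
    acyclic quotient. *)
Lemma hdim_order_complex_below j :
  hdim k (@erank L) (order_complex p) j = hdim k (@erank 'I_n) (below p) j.
Proof.
have inl_inj : injective (@inl L 'I_n) by move=> ? ? [].
have inr_inj : injective (@inr L 'I_n) by move=> ? ? [].
have cvxDelta := convex_lower cvxJ lowDelta; have cvxK := convex_lower cvxJ lowK.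
have cvxC := convex_closed_down (@order_complex_down p).
have cvxB := convex_closed_down (@below_down p).
rewrite -(hdim_transport k j (@erank_inj _) sum_rank_inj inl_inj _ cvxC cvxDelta) //.
rewrite (hdim_lower sum_rank_inj cvxJ lowDelta); last first.
  exact: acyclic_cylinder_over_order_complex.
rewrite -(hdim_transport k j (@erank_inj _) sum_rank_inj inr_inj _ cvxB cvxK); last first.
  by move=> x y; rewrite ltn_add2l.
by rewrite (hdim_lower sum_rank_inj cvxJ lowK) //; apply: acyclic_cylinder_over_below.
Qed.

End Crosscut.

Lemma equivE p : equiv a p = upto p :\: below p.
Proof.
apply/setP => s; rewrite !inE lt_neqAle negb_and negbK.
by case: (eqVneq (jn s) p) => [->|] //=; rewrite ?lexx // andNb.
Qed.

Lemma lower_below p : lower (below p) (upto p).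
Proof.
split; first by apply/subsetP => s; rewrite !inE => /ltW.
by move=> s t sp _ ts; apply: below_down sp ts.
Qed.

Lemma equiv0 : equiv a \bot = [set set0].
Proof. by apply/setP => s; rewrite !inE jn_eq0. Qed.

(** The family [equiv a p] is the full simplex [upto p] minus [below p].  Away from the
    bottom, the first is acyclic and the second has the homology of the open interval, so the connecting map shifts the
    homology of the interval by one degree, as the definition of [betti] does. *)
Lemma bettiE i p : betti k i p = hdim k (@erank 'I_n) (equiv a p) i.
Proof.
have [->|p_neq0] := eqVneq p \bot.
  by rewrite equiv0 hdim_set1 cards0; case: i => [|i] /=; rewrite eqxx.
case: i => [|j] /=; rewrite (negbTE p_neq0).
  rewrite /hdim; suff -> : chains k (equiv a p) 0 = 0%VS by rewrite cap0v dimv0.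
  apply/eqP; rewrite -subv0; apply/subvP => c /memchainsP cp.
  rewrite memv0; apply/eqP/ffunP => s; rewrite ffunE; apply/eqP/negP => /negP/cp[].
  by rewrite inE => /eqP sp /cards0_eq s0; case/eqP: p_neq0; rewrite -sp s0 jn_set0.
rewrite redH_dimE; last exact: order_complex_down.
rewrite hdim_order_complex_below // equivE.
apply/esym/hdim_shift; last exact: acyclic_upto.
- exact: erank_inj.
- exact/convex_closed_down/upto_down.
exact: lower_below.
Qed.

Local Notation S := (scarf a).

(** * Acyclicity and the Scarf complex *)

Lemma scarfP s : reflect (equiv a (jn s) = [set s]) (s \in S).
Proof.
rewrite inE; apply: (iffP cards1P) => [[t tE]|->]; last by exists s.
have : s \in equiv a (jn s) by rewrite inE.
by rewrite tE => /set1P->.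
Qed.

Lemma scarf_inj s t : s \in S -> jn t = jn s -> t = s.
Proof.
by move=> /scarfP sE ts; apply/set1P; rewrite -sE inE ts.
Qed.

Lemma scarfI s : (forall t, jn t = jn s -> t = s) -> s \in S.
Proof.
move=> s_inj; apply/scarfP/setP => t; rewrite !inE.
by apply/eqP/eqP => [/s_inj|->].
Qed.

Lemma scarf_jn s : s \in S = (#|equiv a (jn s)| == 1%N).
Proof. by rewrite inE. Qed.

(** Let [t] be a subset of a Scarf face [s] and let [u] have the same join as [t].  Completing
    [u] by the rest of [s] gives back the join of [s], whence [t \subset u] and [u \subset s].  An
    element [i] of [u] outside [t] would be redundant in [s], as [a i] is below the join of
    [t]. *)
Lemma scarf_down : closed_down S.
Proof.
move=> s t sS ts; apply: scarfI => u ut.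
have usE : u :|: s :\: t = s.
  apply: scarf_inj sS _; apply/le_anti/andP; split; apply/jn_leP => i.
    case/setUP => [iu|/setDP[is_ _]]; last exact: le_jn.
    by apply: le_trans (le_jn iu) _; rewrite ut jn_mono.
  move=> is_; have [it|it] := boolP (i \in t); last by rewrite le_jn // !inE it is_ orbT.
  by apply: le_trans (le_jn it) _; rewrite -ut jn_mono // subsetUl.
apply/setP => i; apply/idP/idP => [iu|it].
  apply/negPn/negP => it; have is_ : i \in s by rewrite -usE inE iu.
  have : s :\ i = s.
    apply: scarf_inj sS _; apply/le_anti/andP; split; first exact/jn_mono/subD1set.
    apply/jn_leP => j js; have [->|ji] := eqVneq j i; last by rewrite le_jn // !inE ji.
    apply: le_trans (le_jn iu) _; rewrite ut; apply/jn_mono/subsetD1P.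
    by split.
  by move/setP/(_ i); rewrite !inE eqxx is_.
by have := subsetP ts i it; rewrite -{1}usE !inE it orbF.
Qed.

Lemma set0_scarf : set0 \in S.
Proof. by apply: scarfI => t /eqP; rewrite jn_set0 jn_eq0 => /eqP. Qed.

Lemma jn_set1 i : jn [set i] = a i.
Proof. by rewrite big_set1. Qed.

Lemma atom_le i j : a i <= a j -> i = j.
Proof.
case: atomicL => a_inj atomP _ ij; apply: a_inj; apply/eqP; apply: contraT => neq_ij.
have [_ /(_ (a i))] : is_atom (a j) by apply: (proj2 (atomP _)); exists j.
by rewrite atom_gt0 lt_neqAle neq_ij ij.
Qed.

Lemma set1_scarf i : [set i] \in S.
Proof.
apply: scarfI => t; rewrite jn_set1 => tE.
have ti j : j \in t -> j = i by move=> jt; apply: atom_le; rewrite -tE le_jn.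
have : t != set0 by rewrite -jn_eq0 tE -lt0x atom_gt0.
case/set0Pn => j jt; apply/setP => l; rewrite inE; apply/idP/eqP => [/ti//|->].
by rewrite -(ti j jt).
Qed.

Lemma simplicial_scarf : simplicial_complex S.
Proof. by split; [exact: set0_scarf | exact: set1_scarf | exact: scarf_down]. Qed.

(** Both [upto p] and [below p] are convertible to families of this form. *)
Definition with_join_in (D : pred L) : {set {set 'I_n}} := [set s : {set 'I_n} | D (jn s)].

Lemma with_join_in_down (D : pred L) :
  (forall x y, x <= y -> D y -> D x) -> closed_down (with_join_in D).
Proof. by move=> Ddown s t; rewrite !inE => Ds /jn_mono ts; apply: Ddown ts Ds. Qed.

Lemma lower_scarfI (W : {set {set 'I_n}}) : lower (W :&: S) W.
Proof.
split; first exact: subsetIl.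
by move=> s t /setIP[_ sS] tW ts; rewrite inE tW (scarf_down sS ts).
Qed.

Lemma setD_scarfI (W : {set {set 'I_n}}) : W :\: (W :&: S) = W :\: S.
Proof. by rewrite setDIr setDv set0U. Qed.

Lemma equiv_scarf0 p : #|equiv a p| != 1%N -> equiv a p :&: S = set0.
Proof.
move=> p1; apply/setP => s; rewrite !inE; apply/andP => -[/eqP->].
by rewrite (negbTE p1).
Qed.

(** The family is fibred by the join; the fibre over [p] is [equiv a p], or is empty when [p] is
    the join of a Scarf face. *)
Lemma acyclic_setD_scarf (D : pred L) :
    (forall x y, x <= y -> D y -> D x) ->
    (forall p, D p -> #|equiv a p| != 1%N -> acyclic k (@erank 'I_n) (equiv a p)) ->
  acyclic k (@erank 'I_n) (with_join_in D :\: S).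
Proof.
move=> Ddown acD; have e_inj := @erank_inj 'I_n.
have cvxD := convex_closed_down (with_join_in_down Ddown).
apply: (@acyclic_fibration _ _ _ e_inj _ (fun s => jn s) (fun x => #|[set y | y <= x]|)).
- by rewrite -setD_scarfI; apply: convex_upper cvxD (lower_scarfI _).
- move=> s t _ _ /jn_mono; rewrite le_eqVlt => /orP[/eqP|lt_ts]; first by left.
  right; apply: proper_card; rewrite properE; apply/andP; split.
    by apply/subsetP => y; rewrite !inE => /le_trans-> //; apply: ltW.
  by apply/subsetPn; exists (jn s); rewrite !inE ?lexx // (lt_geF lt_ts).
move=> x; have [xP|] := boolP (D x && (#|equiv a x| != 1%N)).
  case/andP: xP => Dx x1.
  suff -> : [set s in with_join_in D :\: S | jn s == x] = equiv a x by apply: acD.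
  apply/setP => s; rewrite !in_set; case: (eqVneq (jn s) x) => [->|]; rewrite ?andbF ?andbT //.
  by rewrite x1.
rewrite negb_and negbK => xP.
suff -> : [set s in with_join_in D :\: S | jn s == x] = set0 by apply: acyclic0.
apply/setP => s; rewrite !in_set; case: (eqVneq (jn s) x) => [->|]; rewrite ?andbF ?andbT //.
by case/orP: xP => [/negbTE->|->]; rewrite ?andbF.
Qed.

(** [upto p] is acyclic, and so is what remains of it outside the Scarf complex. *)
Lemma acyclic_scarf_upto :
    (forall p, #|equiv a p| != 1%N -> acyclic k (@erank 'I_n) (equiv a p)) ->
  forall p, p != \bot -> acyclic k (@erank 'I_n) (upto p :&: S).
Proof.
move=> acS p p_neq0 j; have cvxp := convex_closed_down (@upto_down p).
rewrite (hdim_lower (@erank_inj _) cvxp (lower_scarfI _)); first exact: acyclic_upto.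
rewrite setD_scarfI; apply: (@acyclic_setD_scarf (fun x => x <= p)) => [x y|x _].
  exact: le_trans.
exact: acS.
Qed.

(** Outside the Scarf complex, [upto p] splits into [below p] and [equiv a p].  The union is
    acyclic because the Scarf part of [upto p] is, and the first piece is acyclic by induction
    on [p]. *)
Lemma acyclic_equiv_nonscarf :
    (forall p, p != \bot -> acyclic k (@erank 'I_n) (upto p :&: S)) ->
  forall p, #|equiv a p| != 1%N -> acyclic k (@erank 'I_n) (equiv a p).
Proof.
move=> acS p; have e_inj := @erank_inj 'I_n.
have [N] := ubnP #|[set y | y <= p]|; elim: N p => // N IHN p ltpN p1.
have p_neq0 : p != \bot by apply: contra_neq p1 => ->; rewrite equiv0 cards1.
have cvxp := convex_closed_down (@upto_down p).
have cvxU : convex (upto p :\: S).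
  by rewrite -setD_scarfI; apply: convex_upper cvxp (lower_scarfI _).
have acU : acyclic k (@erank 'I_n) (upto p :\: S).
  move=> j; rewrite -setD_scarfI -(hdim_upper e_inj cvxp (lower_scarfI _)).
    exact: acyclic_upto.
  exact: acS.
have acV : acyclic k (@erank 'I_n) (below p :\: S).
  apply: (@acyclic_setD_scarf (fun x => x < p)) => [x y|x xp]; first exact: le_lt_trans.
  apply: IHN; rewrite -ltnS; apply: leq_trans ltpN; rewrite ltnS.
  apply: proper_card; rewrite properE; apply/andP; split.
    by apply/subsetP => y; rewrite !inE => /le_trans-> //; apply: ltW.
  by apply/subsetPn; exists p; rewrite !inE ?lexx // (lt_geF xp).
have lowV : lower (below p :\: S) (upto p :\: S).
  split; first by apply: setSD; case: (lower_below p).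
  move=> s t /setDP[sp _] /setDP[_ tS] ts.
  by rewrite inE tS (below_down sp ts).
have <- : (upto p :\: S) :\: (below p :\: S) = equiv a p.
  rewrite equivE; apply/setP => s; rewrite !in_setD.
  have [sS|sS] := boolP (s \in S) => /=; last by [].
  have : s \notin equiv a p :&: S by rewrite equiv_scarf0 // in_set0.
  by rewrite in_setI sS andbT equivE in_setD /= => /negbTE->.
by move=> j; rewrite -(hdim_upper e_inj cvxU lowV).
Qed.

Definition nb_scarf i : nat := #|[set s in S | #|s| == i]|.

(** When [p] is the join of a Scarf face [s], the family [equiv a p] is [[set s]], whose only
    homology is a line in degree [#|s|]. *)
Lemma total_bettiE i :
  total_betti k L i =
  (nb_scarf i + \sum_(p : L | #|equiv a p| != 1%N) hdim k (@erank 'I_n) (equiv a p) i)%N.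
Proof.
rewrite /total_betti; under eq_bigr do rewrite bettiE.
rewrite (bigID (fun p => #|equiv a p| == 1%N)) /=; congr (_ + _)%N.
have -> : nb_scarf i = (\sum_(s in S) (#|s| == i : nat))%N.
  rewrite /nb_scarf -sum1_card big_mkcond [RHS]big_mkcond /=.
  apply: eq_bigr => s _; rewrite [s \in [set _ in _ | _]]in_set.
  by case: (s \in S) => //=; case: eqP.
rewrite (partition_big (fun s => jn s) (fun p => #|equiv a p| == 1%N)) /=; last first.
  by move=> s; rewrite scarf_jn.
apply: eq_bigr => p /cards1P[s sE]; rewrite sE hdim_set1 (big_pred1 s) ?[i == _]eq_sym // => t.
apply/andP/eqP => [[_ tp]|->].
  by apply/set1P; rewrite -sE inE.
have : s \in equiv a p by rewrite sE set11.
by rewrite inE => /eqP sp; rewrite scarf_jn sp sE cards1 !eqxx.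
Qed.

End LatticeHomology.

(** * Multigraded strands of the cellular complex *)

Lemma mcoeffXM (k : fieldType) (m : nat) (w v : 'X_{1..m}) (p : {mpoly k[m]}) :
  ('X_[w] * p)@_v = if (w <= v)%MM then p@_(v - w) else 0.
Proof.
rewrite mulrC; case: ifPn => [wv|wv].
  by rewrite -[in LHS](submK wv) addmC mcoeffMX.
rewrite [p in LHS]mpolyE mulr_suml raddf_sum big1 // => u _ /=.
rewrite -scalerAl -mpolyXD mcoeffZ mcoeffX; case: eqP => [uwv|]; last by rewrite mulr0.
by rewrite -uwv lem_addl in wv.
Qed.

Lemma lem_anti (m : nat) (u v : 'X_{1..m}) : (u <= v)%MM -> (v <= u)%MM -> u = v.
Proof.
move=> /mnm_lepP uv /mnm_lepP vu; apply/mnmP => i; apply/eqP.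
by rewrite eqn_leq uv vu.
Qed.

Section Multigrading.
Variables (k : fieldType) (m n : nat) (g : 'I_n -> 'X_{1..m}).

Local Notation label := (lcm_label g).
Local Notation chain := {ffun {set 'I_n} -> k^o}.
Local Notation Chain := {ffun {set 'I_n} -> {mpoly k[m]}}.
Local Notation bd := (@bdo _ k (@erank 'I_n)).
Implicit Types (s t : {set 'I_n}) (u w : 'X_{1..m}) (c b : Chain) (x e : chain).

Lemma label_leP (s : {set 'I_n}) u :
  reflect (forall i, i \in s -> (g i <= u)%MM) (label s <= u)%MM.
Proof.
rewrite /lcm_label (big_morph (fun v => v <= u)%MM (id1 := true) (op1 := andb)).
- by rewrite big_andE; apply: forall_inP.
- by move=> v w; rewrite lem_mlcm.
by apply/mnm_lepP => i; rewrite mnm0E.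
Qed.

Lemma le_label (s : {set 'I_n}) i : i \in s -> (g i <= label s)%MM.
Proof. by move: i; apply/label_leP; apply: lepm_refl. Qed.

Lemma label_mono (s t : {set 'I_n}) : t \subset s -> (label t <= label s)%MM.
Proof. by move=> /subsetP ts; apply/label_leP => i /ts; apply: le_label. Qed.

Lemma label_set0 : label set0 = 0%MM.
Proof.
apply: lem_anti; first by apply/label_leP => i; rewrite inE.
by apply/mnm_lepP => i; rewrite mnm0E.
Qed.

Lemma label_set1 i : label [set i] = g i.
Proof.
apply: lem_anti; last by rewrite le_label ?set11.
by apply/label_leP => j /set1P->; apply: lepm_refl.
Qed.

(** The component of multidegree [u] of a chain with polynomial coefficients.  As the basis
    element of [s] has multidegree [label s], the component is an ordinary chain, supported on the
    faces whose label divides [u]. *)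
Definition piece u c : chain :=
  [ffun s : {set 'I_n} => if (label s <= u)%MM then (c s)@_(u - label s) : k^o else 0].

(** The homogeneous chain of multidegree [u] with prescribed component. *)
Definition lift u x : Chain :=
  [ffun s : {set 'I_n} => if (label s <= u)%MM then (x s : k) *: 'X_[u - label s] else 0].

Definition label_upto u : {set {set 'I_n}} := [set s : {set 'I_n} | (label s <= u)%MM].

Lemma pieceD u c b : piece u (c + b) = piece u c + piece u b.
Proof.
by apply/ffunP => s; rewrite !ffunE; case: ifP; rewrite ?addr0 // mcoeffD.
Qed.

Lemma piece0 u : piece u 0 = 0.
Proof. by apply/ffunP => s; rewrite !ffunE; case: ifP; rewrite // mcoeff0. Qed.

Lemma piece_inj c b : (forall u, piece u c = piece u b) -> c = b.
Proof.
move=> cb; apply/ffunP => s; apply/mpolyP => w.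
by have /ffunP/(_ s) := cb (w + label s)%MM; rewrite !ffunE lem_addl addmK.
Qed.

(** The homogenizing factors make the cellular boundary preserve multidegrees; on each
    component it is the simplicial boundary. *)
Lemma piece_cell_bd u c : piece u (cell_bd g c) = bd (piece u c).
Proof.
apply/ffunP => t; rewrite !ffunE; case: ifPn => tu; last first.
  rewrite big1 // => v _; rewrite ffunE ifN ?mulr0 //; apply: contra tu.
  by move/label_leP => vtu; apply/label_leP => i it; apply: vtu; rewrite inE it orbT.
rewrite raddf_sum; apply: eq_bigr => v vt /=; rewrite -mulrA ffunE.
have -> N (p : {mpoly k[m]}) w : ((-1) ^+ N * p)@_w = (-1) ^+ N * p@_w.
  by rewrite -signr_odd -[in RHS]signr_odd; case: odd;
    rewrite ?expr0 ?expr1 ?mul1r // !mulN1r mcoeffN.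
congr (_ * _); rewrite mcoeffXM.
have tvt : (label t <= label (v |: t))%MM by apply/label_mono/subsetUr.
have -> : (label (v |: t) - label t <= u - label t)%MM = (label (v |: t) <= u)%MM.
  apply/mnm_lepP/mnm_lepP => le i; have := le i; rewrite ?mnmBE.
    have /mnm_lepP/(_ i) := tu; have /mnm_lepP/(_ i) := tvt.
    by move=> h1 h2; rewrite leq_subLR subnKC.
  by move=> h; apply: leq_sub2r.
case: ifP => // vtu; congr (_@__); apply/mnmP => i; rewrite !mnmBE.
have /mnm_lepP/(_ i) := tvt; move=> h.
by rewrite subnBA // subnK //; have /mnm_lepP := tu.
Qed.

Lemma piece_lift u w x j : x \in chains k (label_upto u) j ->
  piece w (lift u x) = if w == u then x else 0.
Proof.
move=> /memchainsP xu; apply/ffunP => s; rewrite !ffunE.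
have xs : (label s <= u)%MM = false -> x s = 0.
  by move=> su; apply/eqP/negPn/negP => /xu[]; rewrite inE su.
case: ifPn => [sw|sw].
  case: ifP => [su|/xs s0]; last by rewrite mcoeff0; case: eqP; rewrite ?ffunE ?s0.
  rewrite mcoeffZ mcoeffX; have -> : (u - label s == w - label s)%MM = (w == u).
    apply/eqP/eqP => [E|-> //].
    by rewrite -(submK sw) -E submK.
  by case: eqP => _; rewrite ?mulr1 // mulr0 ffunE.
case: eqP => [wu|]; last by rewrite ffunE.
by rewrite xs // -wu; apply/negbTE.
Qed.

Section Faces.
Variable D : {set {set 'I_n}}.
Hypothesis Ddown : closed_down D.

Lemma piece_chains u j c : in_cell D j c -> piece u c \in chains k (label_upto u :&: D) j.
Proof.
move=> cD; apply/memchainsP => s; rewrite ffunE; case: ifP => [su|]; last by rewrite eqxx.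
move=> cs; have [|sD sj] := cD s; first by apply: contraNneq cs => ->; rewrite mcoeff0.
by rewrite !inE su sD.
Qed.

Lemma lift_in_cell u j x : x \in chains k (label_upto u :&: D) j -> in_cell D j (lift u x).
Proof.
move=> /memchainsP xD s; rewrite ffunE; case: ifP => [su|]; last by rewrite eqxx.
have [->|/xD[/setIP[_ sD] sj] _ //] := eqVneq (x s) 0.
by rewrite scale0r eqxx.
Qed.

Lemma in_cellD j c b : in_cell D j c -> in_cell D j b -> in_cell D j (c + b).
Proof.
move=> cD bD s; rewrite ffunE; have [->|/cD//] := eqVneq (c s) 0.
by rewrite add0r => /bD.
Qed.

Lemma chains_label_upto u j x :
  x \in chains k (label_upto u :&: D) j -> x \in chains k (label_upto u) j.
Proof. exact/chainsS/subsetIl. Qed.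

Definition exact_strands := forall u j x,
  x \in chains k (label_upto u :&: D) j.+1 -> bd x = 0 ->
  exists2 e, e \in chains k (label_upto u :&: D) j.+2 & bd e = x.

Definition exact_cells := forall j c, in_cell D j.+1 c ->
  (cell_bd g c = 0 <-> exists2 b, in_cell D j.+2 b & cell_bd g b = c).

Lemma exact_cells_strands : exact_cells -> exact_strands.
Proof.
move=> exD u j x xD x0; have xu := chains_label_upto xD.
have [bdry _] := exD j (lift u x) (lift_in_cell xD); have [|b bD bE] := bdry.
  apply: piece_inj => w; rewrite piece_cell_bd (piece_lift _ xu) piece0.
  by case: eqP => _; rewrite ?x0 ?linear0.
exists (piece u b); first exact: piece_chains.
by rewrite -piece_cell_bd bE (piece_lift _ xu) eqxx.
Qed.

(** A chain has finitely many nonzero components.  Bounding them one at a time and lifting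
    each bounding chain to its multidegree bounds the whole chain. *)
Lemma exact_strands_cells : exact_strands -> exact_cells.
Proof.
move=> exD j c cD; split=> [c0|[b bD <-]]; last first.
  apply: piece_inj => u; rewrite !piece_cell_bd piece0.
  exact/bdoK/erank_inj.
pose degs := undup [seq (w + label s)%MM | s <- enum {set 'I_n}, w <- msupp (c s)].
have degsP u : u \notin degs -> piece u c = 0.
  move=> uN; apply/ffunP => s; rewrite !ffunE; case: ifP => // su.
  apply/eqP; rewrite mcoeff_eq0; apply: contra uN => uc; rewrite mem_undup.
  by apply/allpairsPdep; exists s, (u - label s)%MM; rewrite mem_enum uc submK.
suff [b bD bE] : exists2 b, in_cell D j.+2 b &
    forall u, piece u (cell_bd g b) = if u \in degs then piece u c else 0.
  exists b => //; apply: piece_inj => u; rewrite bE.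
  by case: ifPn => // /degsP.
elim: degs (undup_uniq _ : uniq degs) {degsP} => [_|u degs IH /= /andP[uN /IH[b bD bE]]].
  exists 0; first by move=> s; rewrite ffunE eqxx.
  by move=> u; rewrite piece_cell_bd piece0 linear0.
have [|e eD eE] := exD u j (piece u c) (piece_chains u cD).
  by rewrite -piece_cell_bd c0 piece0.
exists (b + lift u e); first exact: in_cellD bD (lift_in_cell eD).
move=> w; rewrite piece_cell_bd pieceD linearD /= -piece_cell_bd bE.
rewrite (piece_lift _ (chains_label_upto eD)) inE.
case: eqVneq => [->|_] /=; first by rewrite (negbTE uN) add0r eE.
by rewrite linear0 addr0.
Qed.

Lemma in_ideal_cells : (forall i, [set i] \in D) ->
  forall r : {mpoly k[m]}, in_ideal g r <-> exists2 c, in_cell D 1 c & cell_bd g c set0 = r.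
Proof.
move=> D1 r.
have bdE c : cell_bd g c set0 = \sum_(i < n) c [set i] * 'X_[g i].
  rewrite ffunE; apply: eq_big => [i|i _]; first by rewrite inE.
  rewrite setU0; have -> : incidence i [set i] = 0%N.
    by apply/eqP; rewrite cards_eq0; apply/eqP/setP => v; rewrite !inE;
      case: eqP => [->|] //=; rewrite ltnn.
  rewrite expr0 mul1r mulrC; congr (_ * 'X_[_]).
  by rewrite label_set0 label_set1; apply/mnmP => v; rewrite mnmBE mnm0E subn0.
split=> [[h ->]|[c _ <-]]; last by exists (fun i => c [set i]); rewrite bdE.
exists [ffun s : {set 'I_n} => \sum_(i < n | s == [set i]) h i].
  move=> s; rewrite ffunE; case: (pickP (fun i => s == [set i])) => [i /eqP-> _|sN].
    by rewrite D1 cards1.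
  by rewrite big_pred0 ?eqxx.
rewrite bdE; apply: eq_bigr => i _; rewrite ffunE (big_pred1 i) // => v.
by rewrite (inj_eq set1_inj) eq_sym.
Qed.

(** A unit entry in the differential would come from a face and a facet of it with the same
    label. *)
Lemma minimal_of_distinct_labels :
    (forall s t, s \in D -> label t = label s -> t = s) -> cellular_minimal k g D.
Proof.
move=> inj_label Chain j c cD t; rewrite ffunE raddf_sum big1 //= => v vt.
have [->|/cD[vtD _]] := eqVneq (c (v |: t)) 0; first by rewrite mulr0 mcoeff0.
rewrite -mulrA -signr_odd mulr_sign.
suff E : ('X_[label (v |: t) - label t] * c (v |: t))@_0%MM = 0.
  by case: odd => /=; rewrite ?mcoeffN E ?oppr0.
rewrite mcoeffXM ifN //; apply: contra vt => /mnm_lepP le0.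
rewrite {1}(inj_label (v |: t) t) ?setU11 //.
apply: lem_anti; first by apply/label_mono/subsetUr.
by apply/mnm_lepP => i; have := le0 i; rewrite mnmBE mnm0E leqn0 subn_eq0.
Qed.

End Faces.
End Multigrading.

(** * Resolutions supported on the Scarf complex *)

Section ScarfResolution.
Variables (k : fieldType) (d : Order.disp_t) (L : finTBLatticeType d).
Variables (n : nat) (a : 'I_n -> L).
Hypothesis atomicL : atomic_lattice a.
Local Open Scope order_scope.

Local Notation jn s := (\join_(i in s) a i).
Local Notation S := (scarf a).

Section Coordinates.
Variables (m : nat) (g : 'I_n -> 'X_{1..m}) (phi : L -> 'X_{1..m}).
Hypothesis phi_le : forall x y, (x <= y)%O = (phi x <= phi y)%MM.
Hypothesis phi_img : forall u, (exists x, phi x = u) <-> (exists s, lcm_label g s = u).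
Hypothesis phi_atom : forall i, phi (a i) = g i.

Lemma label_jn (s : {set 'I_n}) : lcm_label g s = phi (jn s).
Proof.
have [x xE] : exists x, phi x = lcm_label g s by apply/phi_img; exists s.
rewrite -xE; congr phi; apply/le_anti/andP; split; last first.
  by apply/jn_leP => i is_; rewrite phi_le phi_atom xE le_label.
rewrite phi_le xE; apply/label_leP => i is_; rewrite -phi_atom -phi_le.
exact: le_jn.
Qed.

Lemma label_upto_phi p : label_upto g (phi p) = upto a p.
Proof. by apply/setP => s; rewrite !inE label_jn phi_le. Qed.

(** The join of the generators dividing [u] divides [u] as well, so a label divides [u]
    exactly when the join of the face is below that element. *)
Lemma label_upto_upto u : exists p, label_upto g u = upto a p.
Proof.
exists (jn [set i | (g i <= u)%MM]); apply/setP => s; rewrite [LHS]inE [RHS]inE.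
apply/label_leP/idP => [su|].
  by apply: jn_mono; apply/subsetP => i /su; rewrite inE.
rewrite phi_le -!label_jn => /label_leP le_s i /le_s/lepm_trans; apply.
by apply/label_leP => j; rewrite inE.
Qed.

Lemma distinct_scarf_labels s t : s \in S -> lcm_label g t = lcm_label g s -> t = s.
Proof.
move=> sS; rewrite !label_jn => E; apply: scarf_inj sS _.
by apply/le_anti; rewrite !phi_le E lepm_refl.
Qed.

(** The left side speaks of chains on nonempty faces only.  Away from the minimum, exactness at
    the empty face is automatic, since all the vertices belong to the Scarf complex; at the
    minimum, the empty face is the only one. *)
Lemma exact_strands_acyclic :
  exact_strands k g S <-> forall p, p != \bot -> acyclic k (@erank 'I_n) (upto a p :&: S).
Proof.
have downU p : closed_down (upto a p :&: S).
  move=> s t /setIP[sp sS] ts; rewrite inE (scarf_down sS ts).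
  by rewrite (upto_down sp ts).
have e_inj := @erank_inj 'I_n.
have bdWE p j c : c \in chains k (upto a p :&: S) j ->
    bdW (@erank 'I_n) (upto a p :&: S) c = bdo (@erank 'I_n) c.
  by move=> cp; apply: (bdW_closed_down _ (downU p) cp).
split=> [exS p p_neq0|acS u j x].
  apply/(acyclicP k e_inj (convex_closed_down (downU p))) => -[|j] c cp c0.
    have cvxp := convex_closed_down (@upto_down _ _ _ a p).
    have acp := acyclic_upto k atomicL p_neq0.
    have c_up : c \in chains k (upto a p) 0 by apply: chainsS cp; apply: subsetIl.
    have [|e ep eE] := (proj1 (acyclicP k e_inj cvxp) acp) 0 c c_up.
      exact: bdW_chains0 c_up.
    have eS : e \in chains k (upto a p :&: S) 1.
      apply/memchainsP => s /(elimT (memchainsP _ _ _) ep)[sp s1]; split=> //.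
      by have /eqP/cards1P[i sE] := s1; rewrite inE sp sE set1_scarf.
    by exists e; rewrite // (bdWE _ _ _ eS) -(bdW_closed_down _ (@upto_down _ _ _ a p) ep).
  have [||e ep eE] := exS (phi p) j c; rewrite ?label_upto_phi //.
    by rewrite -(bdWE _ _ _ cp).
  by rewrite label_upto_phi in ep; exists e; rewrite ?(bdWE _ _ _ ep).
have [p ->] := label_upto_upto u => xp x0.
have [p0|p_neq0] := eqVneq p \bot.
  exists 0; rewrite ?mem0v // linear0; apply/esym/ffunP => s; rewrite ffunE.
  apply/eqP/negPn/negP => /(elimT (memchainsP _ _ _) xp)[/setIP[sp _]].
  by move: sp; rewrite inE p0 lex0 jn_eq0 // => /eqP->; rewrite cards0.
have [|e ep eE] := (proj1 (acyclicP k e_inj (convex_closed_down (downU p))) (acS p p_neq0)) _ _ xp.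
  by rewrite (bdWE _ _ _ xp).
by exists e; rewrite // -(bdWE _ _ _ ep).
Qed.

End Coordinates.

(** One variable for each element [z] of the lattice; it divides the monomial of [x] unless
    [x <= z].  The monomial of a join is then the least common multiple. *)
Definition lattice_exponent (x : L) : 'X_{1..#|L|} :=
  [multinom (~~ (x <= enum_val j)%O : nat) | j < #|L|].

Lemma le_lattice_exponent x y :
  (x <= y)%O = (lattice_exponent x <= lattice_exponent y)%MM.
Proof.
apply/idP/mnm_lepP => [xy j|le_xy].
  rewrite !mnmE; case: (boolP (y <= _)) => [yj|_]; last exact: leq_b1.
  by rewrite (le_trans xy yj).
have := le_xy (enum_rank y); rewrite !mnmE enum_rankK lexx /=.
by case: (x <= y).
Qed.

Lemma exists_coordinatization :
  exists m (g : 'I_n -> 'X_{1..m}), coordinatization g a.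
Proof.
pose g i := lattice_exponent (a i); exists #|L|, g.
have label_exponent s : lcm_label g s = lattice_exponent (jn s).
  apply: lem_anti; first by apply/label_leP => i is_; rewrite -le_lattice_exponent le_jn.
  apply/mnm_lepP => j; rewrite mnmE; case: (boolP (jn s <= _)) => //= sj.
  have [i is_ ij] : exists2 i, i \in s & ~~ (a i <= enum_val j).
    case: (pickP (fun i => (i \in s) && ~~ (a i <= enum_val j))) => [i /andP[]|none].
      by exists i.
    case/negP: sj; apply/jn_leP => i is_; have := none i; rewrite is_ /=.
    by move/negbFE.
  by have /mnm_lepP/(_ j) := le_label g is_; apply: leq_trans; rewrite mnmE ij.
split; first by move=> i j; rewrite -le_lattice_exponent => /(atom_le atomicL).
exists lattice_exponent; split=> //; first exact: le_lattice_exponent.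
move=> u; split=> [[x <-]|[s <-]]; last by exists (jn s).
by have [s <-] := exists_jn atomicL x; exists s; apply: label_exponent.
Qed.

(** The condition on the right speaks of the lattice alone, so it lets one pass from an
    arbitrary coordinatization to the one of [exists_coordinatization]. *)
Lemma minimally_resolved_by_scarfP :
  minimally_resolved_by_scarf k a <->
  forall p, #|equiv a p| != 1%N -> acyclic k (@erank 'I_n) (equiv a p).
Proof.
split=> [[_ [m [g [[_ [phi [phi_le phi_img phi_atom]]] [_ exS] _]]]]|acS].
  apply: acyclic_equiv_nonscarf => //.
  apply/(exact_strands_acyclic phi_le phi_img phi_atom).
  exact: exact_cells_strands exS.
split; first exact: simplicial_scarf.
have [m [g coordg]] := exists_coordinatization; exists m, g; split=> //.
  split; first by apply: in_ideal_cells => i; apply: set1_scarf.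
  case: coordg => _ [phi [phi_le phi_img phi_atom]].
  apply: exact_strands_cells; apply/(exact_strands_acyclic phi_le phi_img phi_atom).
  exact: acyclic_scarf_upto.
case: coordg => _ [phi [phi_le phi_img phi_atom]].
apply: minimal_of_distinct_labels => s t.
exact: (distinct_scarf_labels phi_le phi_img phi_atom).
Qed.

End ScarfResolution.

(** * Comparison of the two lattices *)

Section Monotonicity.
Local Open Scope order_scope.
Variables (n : nat) (dP dQ : Order.disp_t).
Variables (P : finTBLatticeType dP) (Q : finTBLatticeType dQ).
Variables (aP : 'I_n -> P) (aQ : 'I_n -> Q).
Hypothesis atomicQ : atomic_lattice aQ.
Hypothesis leQ : atomic_le aP aQ.

(** A map preserving binary joins need not preserve the bottom element, so it is only known to
    commute with the joins of nonempty sets; the empty set is treated apart, being the only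
    one whose join is the bottom. *)
Lemma join_eq_transfer (s t : {set 'I_n}) :
  \join_(i in s) aQ i = \join_(i in t) aQ i -> \join_(i in s) aP i = \join_(i in t) aP i.
Proof.
case: leQ => f [fU fa].
have f_mono x y : x <= y -> f x <= f y by rewrite !leEjoin -fU => /eqP->.
have f_jn (r : {set 'I_n}) : r != set0 -> f (\join_(i in r) aQ i) = \join_(i in r) aP i.
  case/set0Pn => i0 i0r; apply/le_anti/andP; split; last first.
    by apply/joinsP => i ir; rewrite -fa f_mono // le_jn.
  have : f \bot <= \join_(i in r) aP i.
    by apply: le_trans (f_mono _ _ (le0x (aQ i0))) _; rewrite fa le_jn.
  move=> f0; elim/big_ind: (\join_(i in r) aQ i) => // [x y fx fy|i ir].
    by rewrite fU leUx fx fy.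
  by rewrite fa le_jn.
move=> st; have [s0|s_neq0] := eqVneq s set0.
  have := jn_eq0 atomicQ t; rewrite -st s0 jn_set0 eqxx => /esym/eqP->.
  by [].
have [t0|t_neq0] := eqVneq t set0.
  have := jn_eq0 atomicQ s; rewrite st t0 jn_set0 eqxx.
  by rewrite (negbTE s_neq0).
by rewrite -!f_jn // st.
Qed.

Lemma scarf_subset : scarf aP \subset scarf aQ.
Proof.
apply/subsetP => s sP; apply: scarfI => t /join_eq_transfer.
exact: scarf_inj sP.
Qed.

End Monotonicity.

Theorem proposition6p4 (k : fieldType) (n : nat)
    (dP dQ : Order.disp_t)
    (P : finTBLatticeType dP) (Q : finTBLatticeType dQ)
    (aP : 'I_n -> P) (aQ : 'I_n -> Q)
    (hP : atomic_lattice aP) (hQ : atomic_lattice aQ)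
    (hres : minimally_resolved_by_scarf k aP)
    (hle : atomic_le aP aQ)
    (hbetti : forall i : nat, total_betti k Q i = total_betti k P i) :
  minimally_resolved_by_scarf k aQ /\ scarf aQ = scarf aP.
Proof.
have acP := proj1 (minimally_resolved_by_scarfP k hP) hres.
have sPQ := scarf_subset hQ hle.
have sPQi i : [set s in scarf aP | #|s| == i] \subset [set s in scarf aQ | #|s| == i].
  by apply/subsetP => s /setIdP[/(subsetP sPQ) sQ si]; rewrite in_set sQ.
have bettiP i : total_betti k P i = nb_scarf aP i.
  by rewrite (total_bettiE k hP) big1 ?addn0 // => p p1; apply: acP.
have squeeze i : nb_scarf aQ i = nb_scarf aP i /\
    (\sum_(q : Q | #|equiv aQ q| != 1) hdim k (@erank 'I_n) (equiv aQ q) i = 0)%N.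
  have := hbetti i; rewrite bettiP (total_bettiE k hQ).
  have := subset_leq_card (sPQi i); rewrite -!/(nb_scarf _ i) => le_PQ sumE.
  have le_QP : (nb_scarf aQ i <= nb_scarf aP i)%N by rewrite -sumE leq_addr.
  have E : nb_scarf aQ i = nb_scarf aP i by apply/eqP; rewrite eqn_leq le_QP.
  by split=> //; apply/eqP; rewrite -(eqn_add2l (nb_scarf aQ i)) sumE E addn0.
split.
  apply/(minimally_resolved_by_scarfP k hQ) => q q1 i; have [_ /eqP] := squeeze i.
  by rewrite sum_nat_eq0 => /forall_inP/(_ q q1)/eqP.
apply/esym/eqP; rewrite eqEsubset sPQ /=; apply/subsetP => s sQ.
have /setP/(_ s) : [set t in scarf aP | #|t| == #|s|] = [set t in scarf aQ | #|t| == #|s|].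
  by apply/eqP; rewrite eqEcard sPQi -!/(nb_scarf _ #|s|) (squeeze _).1 leqnn.
rewrite [s \in [set _ in _ | _]]in_set [RHS]in_set eqxx !andbT => ->.
exact: sQ.
Qed.
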